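(* $\mathsf{WF}\leq_{\mathrm W}\mathsf{LPO}\star\mathsf{LL}_{\bm{\Sigma}^0_1}$, and consequently $\mathsf{LL}_{\bm{\Sigma}^0_1}\nleq_{\mathrm W}\mathsf{C}_{\omega^\omega}$.
   Context: Weihrauch reducibility: for partial multi-valued functions $f,g$ between represented spaces, a realizer of $g$ is a partial $G$ on $\omega^\omega$ sending each name of each $x\in\mathrm{dom}(g)$ to a name of an element of $g(x)$. $f\leq_{\mathrm W}g$ if there are computable partial $\varphi,\psi$ on $\omega^\omega$ such that for every realizer $G$ of $g$, $p\mapsto\psi(\langle p,G(\varphi(p))\rangle)$ is a realizer of $f$. The compositional product $f\star g$ is (up to Weihrauch equivalence) the $\leq_{\mathrm W}$-greatest problem among $f_0\circ g_0$ with $f_0\leq_{\mathrm W}f$, $g_0\leq_{\mathrm W}g$ (apply $g$, then a computable operation, then $f$). An open subset of $\omega^\omega$ is named by an enumeration of a set $A\subseteq\omega^{<\omega}$ with the open set equal to $\{f:\exists\tau\prec f\ (\tau\in A)\}$. A Laver tree (always with empty stem) is a prefix-closed $T\subseteq\omega^{<\omega}$ containing $\langle\rangle$ such that every $\sigma\in T$ has infinitely many immediate successors in $T$; $[T]$ is the set of infinite paths. $\mathrm{LT}:\omega^\omega\to\{\text{Laver trees}\}$ is a total bijective representation of Laver trees, computably equivalent to the representation via characteristic functions. $\mathsf{LL}_{\bm{\Sigma}^0_1}:\bm{\Sigma}^0_1(\omega^\omega)\rightrightarrows\omega^\omega$ maps an open set $A$ to $\{f:[\mathrm{LT}(f)]\subseteq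 A\ \lor\ [\mathrm{LT}(f)]\cap A=\emptyset\}$. $\mathsf{WF}$ maps a tree $T\subseteq\omega^{<\omega}$ (given by its characteristic function) to $1$ if $[T]\neq\emptyset$ and to $0$ otherwise. $\mathsf{LPO}:2^\omega\to2$ maps $p$ to $1$ if $p(n)=1$ for some $n$, and to $0$ otherwise. $\mathsf{C}_{\omega^\omega}$ maps a tree $T\subseteq\omega^{<\omega}$ with $[T]\neq\emptyset$ to $[T]$ (any path is an admissible output). *)

(* Defs.v *)
(* This development uses the Rocq standard library only. *)
From Stdlib Require Import List Arith Cantor.
From Stdlib Require Import Classical ClassicalChoice.
From Stdlib Require Import FunctionalExtensionality PropExtensionality ProofIrrelevance.
Import ListNotations.

Definition baire : Type := nat -> nat.

(** * Computability on Baire space *)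

(** Oracle (mu-)recursive functions of one argument, with tuples handled by the
    Cantor pairing [Cantor.to_nat : nat * nat -> nat]. *)
Inductive code : Type :=
| CZero | CSucc | CFst | CSnd | COracle
| CPair (c d : code)
| CComp (c d : code)
| CPrec (c d : code)
| CMu (c : code).

(** [eval p c n v]: program [c] with oracle [p] halts on input [n] with output [v]. *)
Fixpoint eval (p : baire) (c : code) : nat -> nat -> Prop :=
  match c with
  | CZero => fun _ v => v = 0
  | CSucc => fun n v => v = S n
  | CFst => fun n v => v = fst (Cantor.of_nat n)
  | CSnd => fun n v => v = snd (Cantor.of_nat n)
  | COracle => fun n v => v = p n
  | CPair c d => fun n v =>
      exists a b, eval p c n a /\ eval p d n b /\ v = Cantor.to_nat (a, b)
  | CComp c d => fun n v => exists a, eval p d n a /\ eval p c a v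
  | CPrec c d => fun n =>
      let a := fst (Cantor.of_nat n) in
      let fix loop (m : nat) : nat -> Prop :=
        match m with
        | 0 => eval p c a
        | S k => fun v => exists u,
            loop k u /\ eval p d (Cantor.to_nat (a, Cantor.to_nat (k, u))) v
        end in
      loop (snd (Cantor.of_nat n))
  | CMu c => fun a n =>
      eval p c (Cantor.to_nat (a, n)) 0 /\
      forall m, m < n -> exists k, eval p c (Cantor.to_nat (a, m)) (S k)
  end.

(** Partial functions on Baire space are given by their graphs. *)
Definition partial_function (F : baire -> baire -> Prop) : Prop :=
  forall p q q', F p q -> F p q' -> q = q'.

(** As usual in computable analysis, the machine is constrained on the domain
    of [F] only. *)
Definition computable (F : baire -> baire -> Prop) : Prop :=
  partial_function F /\
  exists c : code, forall p q, F p q -> forall n, eval p c n (q n).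

Definition pairing (p q : baire) : baire :=
  fun n => if Nat.even n then p (Nat.div2 n) else q (Nat.div2 n).

(** * Represented spaces, problems, Weihrauch reducibility *)

(** [names p x]: [p] is a name of [x].  So [names] is the graph of a partial
    surjection from Baire space onto [carrier]. *)
Record repspace : Type := RepSpace {
  carrier :> Type;
  names : baire -> carrier -> Prop;
  names_functional : forall p x y, names p x -> names p y -> x = y;
  names_onto : forall x, exists p, names p x
}.

(** Partial multi-valued functions. *)
Definition problem (X Y : repspace) : Type := X -> Y -> Prop.

Definition dom {X Y : repspace} (f : problem X Y) (x : X) : Prop :=
  exists y, f x y.

Definition realizer {X Y : repspace} (G : baire -> baire -> Prop)
    (g : problem X Y) : Prop :=
  partial_function G /\
  forall p x, names X p x -> dom g x ->
    exists q y, G p q /\ names Y q y /\ g x y.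

Definition weihrauch_le {X Y Z W : repspace}
    (f : problem X Y) (g : problem Z W) : Prop :=
  exists phi psi : baire -> baire -> Prop,
    computable phi /\ computable psi /\
    forall G, realizer G g ->
      realizer (fun p r => exists u v, phi p u /\ G u v /\ psi (pairing p v) r) f.

Notation "f '<=W' g" := (weihrauch_le f g) (at level 70, no associativity).

Definition weihrauch_equiv {X Y Z W : repspace}
    (f : problem X Y) (g : problem Z W) : Prop :=
  f <=W g /\ g <=W f.

(** Composition of multi-valued functions:
    [dom (f o g)] consists of the [x] in [dom g] with [g x] included in [dom f]. *)
Definition compose {X Y Z : repspace} (f : problem Y Z) (g : problem X Y) :
    problem X Z :=
  fun x z => (forall y, g x y -> dom f y) /\ exists y, g x y /\ f y z.

(** [h] is a compositional product of [f] and [g]: up to equivalence, it is the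
    greatest of the problems [f0 o g0] with [f0 <=W f] and [g0 <=W g].  The
    product is thus determined only up to Weihrauch equivalence. *)
Definition is_compositional_product {X Y Z W U V : repspace}
    (f : problem X Y) (g : problem Z W) (h : problem U V) : Prop :=
  (exists (A B C : repspace) (f0 : problem B C) (g0 : problem A B),
      f0 <=W f /\ g0 <=W g /\ weihrauch_equiv h (compose f0 g0)) /\
  (forall (A B C : repspace) (f0 : problem B C) (g0 : problem A B),
      f0 <=W f -> g0 <=W g -> compose f0 g0 <=W h).

(** * Finite strings, trees *)

(** A computable bijection between finite strings and natural numbers. *)
Fixpoint str_code (s : list nat) : nat :=
  match s with
  | [] => 0
  | a :: s' => S (Cantor.to_nat (a, str_code s'))
  end.

Lemma str_code_inj s t : str_code s = str_code t -> s = t.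
Proof.
  revert t; induction s as [|a s IH]; intros [|b t]; cbn [str_code]; intro H;
    try discriminate; auto.
  apply eq_add_S, Cantor.to_nat_inj in H. injection H as -> H.
  now rewrite (IH _ H).
Qed.

Definition restrict (f : baire) (n : nat) : list nat := map f (seq 0 n).

Definition initial_segment (s : list nat) (f : baire) : Prop :=
  s = restrict f (length s).

Definition is_tree (T : list nat -> Prop) : Prop :=
  forall s t, T (s ++ t) -> T s.

Definition path (T : list nat -> Prop) (f : baire) : Prop :=
  forall n, T (restrict f n).

Definition is_laver (T : list nat -> Prop) : Prop :=
  is_tree T /\ T [] /\
  forall s, T s -> forall n, exists m, n <= m /\ T (s ++ [m]).

Definition tree : Type := {T : list nat -> Prop | is_tree T}.

Definition laver_tree : Type := {T : list nat -> Prop | is_laver T}.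

(** [p] is the characteristic function of [T], via [str_code]; no condition is
    needed elsewhere, [str_code] being onto. *)
Definition char_name (p : baire) (T : list nat -> Prop) : Prop :=
  forall s, (T s /\ p (str_code s) = 1) \/ (~ T s /\ p (str_code s) = 0).

(** * Representations of Laver trees *)

Definition translatable {X : Type} (d e : baire -> X -> Prop) : Prop :=
  exists F, computable F /\ forall p x, d p x -> exists q, F p q /\ e q x.

Record laver_representation (LT : baire -> laver_tree) : Prop := {
  LT_injective : forall f g, LT f = LT g -> f = g;
  LT_surjective : forall T, exists f, LT f = T;
  LT_to_char : translatable (fun p T => LT p = T)
                            (fun p T => char_name p (proj1_sig T));
  LT_of_char : translatable (fun p T => char_name p (proj1_sig T))
                            (fun p T => LT p = T)
}.

(** * The represented spaces involved *)

Lemma char_name_functional p T T' : char_name p T -> char_name p T' -> T = T'.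
Proof.
  intros H H'. extensionality s. apply propositional_extensionality.
  destruct (H s) as [[a b]|[a b]], (H' s) as [[c d]|[c d]]; rewrite b in d;
    try discriminate; tauto.
Qed.

Lemma str_code_section : exists g, forall s, g (str_code s) = s.
Proof.
  enough (E : forall k n, n <= k -> {s | str_code s = n}).
  { exists (fun n => proj1_sig (E n n (le_n n))). intro s.
    apply str_code_inj. apply proj2_sig. }
  induction k as [|k IH]; intros [|n] Hn; try (exists []; reflexivity).
  { exfalso; inversion Hn. }
  destruct (IH (snd (Cantor.of_nat n))) as [s Hs].
  { apply Nat.le_trans with n; [|now apply le_S_n].
    pose proof (Cantor.to_nat_non_decreasing (fst (Cantor.of_nat n))
                  (snd (Cantor.of_nat n))) as Hd.
    rewrite <- surjective_pairing, Cantor.cancel_to_of in Hd.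
    eapply Nat.le_trans; [apply Nat.le_add_r|exact Hd]. }
  exists (fst (Cantor.of_nat n) :: s). cbn [str_code].
  now rewrite Hs, <- surjective_pairing, Cantor.cancel_to_of.
Qed.

Lemma char_name_onto T : exists p, char_name p T.
Proof.
  destruct str_code_section as [g Hg].
  assert (D : forall n, exists v, (T (g n) /\ v = 1) \/ (~ T (g n) /\ v = 0)).
  { intro n. destruct (Classical_Prop.classic (T (g n))); eauto. }
  apply ClassicalChoice.choice in D. destruct D as [p Hp].
  exists p. intro s. specialize (Hp (str_code s)). now rewrite Hg in Hp.
Qed.

Lemma sig_eq {A : Type} {P : A -> Prop} (x y : {a | P a}) :
  proj1_sig x = proj1_sig y -> x = y.
Proof.
  destruct x as [x hx], y as [y hy]; cbn; intros ->.
  f_equal; apply proof_irrelevance.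
Qed.

Definition Baire : repspace.
Proof.
  refine (RepSpace baire (fun p x => p = x) _ _).
  - intros; congruence.
  - intro x; now exists x.
Defined.

Definition Two : repspace.
Proof.
  refine (RepSpace bool (fun p b => p 0 = Nat.b2n b) _ _).
  - intros p [] [] H H'; rewrite H in H'; easy.
  - intro b; now exists (fun _ => Nat.b2n b).
Defined.

Definition CantorSpace : repspace.
Proof.
  refine (RepSpace (nat -> bool) (fun p x => forall n, p n = Nat.b2n (x n)) _ _).
  - intros p x y H H'. extensionality n. specialize (H n). specialize (H' n).
    rewrite H in H'. now destruct (x n), (y n).
  - intro x; now exists (fun n => Nat.b2n (x n)).
Defined.

Definition Tree : repspace.
Proof.
  refine (RepSpace tree (fun p T => char_name p (proj1_sig T)) _ _).
  - intros p T T' H H'. apply sig_eq. eapply char_name_functional; eauto.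
  - intro T. apply char_name_onto.
Defined.

(** The open set generated by a set of finite strings. *)
Definition cylinders (A : list nat -> Prop) : baire -> Prop :=
  fun f => exists s, A s /\ initial_segment s f.

Definition is_open (U : baire -> Prop) : Prop :=
  exists A, forall f, U f <-> cylinders A f.

(** The set of strings enumerated by [p]; the value [0] enumerates nothing, so
    that the empty set has an enumeration. *)
Definition enumerated (p : baire) : list nat -> Prop :=
  fun s => exists n, p n = S (str_code s).

Definition OpenSets : repspace.
Proof.
  refine (RepSpace {U : baire -> Prop | is_open U}
            (fun p U => forall f, proj1_sig U f <-> cylinders (enumerated p) f) _ _).
  - intros p U V H H'. apply sig_eq. extensionality f.
    apply propositional_extensionality. now rewrite H, H'.
  - intros [U [A HA]]; cbn.
    destruct str_code_section as [g Hg].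
    assert (D : forall n, exists v,
      (A (g n) /\ v = S (str_code (g n))) \/ (~ A (g n) /\ v = 0)).
    { intro n. destruct (Classical_Prop.classic (A (g n))); eauto. }
    apply ClassicalChoice.choice in D. destruct D as [p Hp].
    exists p. intro f. rewrite HA. unfold cylinders.
    split; intros [s [Hs Hf]]; exists s; split; auto.
    + exists (str_code s). specialize (Hp (str_code s)). rewrite Hg in Hp.
      destruct Hp as [[_ Hp]|[Hp _]]; [exact Hp|contradiction].
    + destruct Hs as [n Hn]. destruct (Hp n) as [[a b]|[_ b]].
      * rewrite Hn in b. apply eq_add_S, str_code_inj in b. now subst.
      * rewrite Hn in b. discriminate.
Defined.

(** * The problems *)

(** Homogeneous Laver trees for open sets. *)
Definition LL (LT : baire -> laver_tree) : problem OpenSets Baire :=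
  fun U f =>
    (forall x, path (proj1_sig (LT f)) x -> proj1_sig U x) \/
    (forall x, path (proj1_sig (LT f)) x -> ~ proj1_sig U x).

Definition WF : problem Tree Two :=
  fun T b => b = true <-> exists x, path (proj1_sig T) x.

Definition LPO : problem CantorSpace Two :=
  fun p b => b = true <-> exists n, p n = true.

Definition C_Baire : problem Tree Baire :=
  fun T x => path (proj1_sig T) x.

(* Main.v *)
From Stdlib Require Import List Arith Cantor Lia.
From Stdlib Require Import Classical ClassicalChoice FunctionalExtensionality PropExtensionality.
Require Import Defs.
Import ListNotations.

(** The reduction of WF rests on the open set [A_T] attached to a tree [T]:
    [g] belongs to [A_T] when for some [n] no string of [T] of length [n] is
    pointwise bounded by [g] and has a code at most [g n].  If [T] has a path
    [f], every [g] that dominates [f] and the codes of its initial segments is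
    outside [A_T] ([dominating_not_escape]); if [g] is outside [A_T], the
    strings of [T] below [g] form an infinite finitely branching tree, so that
    [T] has a path ([not_escape_path]).  Bounding codes by [g n] is what makes
    membership in [A_T] a bounded search, hence [A_T] enumerable from [T].

    Let [L] be a Laver tree homogeneous for [A_T].  The paths of [L] dominate
    any prescribed function, so if [T] has a path then some path of [L] is
    outside [A_T], hence all are; if [T] has none then all paths of [L] are in
    [A_T].  As every string of [L] extends to a path of [L], the second case
    is the one in which [L] contains a string of the enumeration of [A_T], and
    this is a single question to LPO ([homogeneous_decides]).  So WF is
    literally a composition of a problem below LPO after a problem below LL
    ([WF_compose]).

    That the compositional product exists is shown for LPO after any problem
    [g] ([LPO_product]).  The input consists of an input for [g] and a table
    on finite strings; the question put to LPO after receiving a solution [w]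
    of [g] is whether the table accepts some initial segment of [w].  To
    reduce an arbitrary composition to this, the machine that turns a solution
    of [g] into a question for LPO must be tabulated on finite parts of its
    oracle; [simulate] is a step-bounded evaluation of a fixed machine on a
    partial oracle, and [tc_simulate] shows that it is computable.  The same
    simulation yields determinism of the machines ([eval_det]) and continuity
    of what they compute ([eval_use]).

    If LL were below [C_Baire], then by the above [T] would be well-founded if
    and only if some path [x] of a tree computed from [T] makes a computation
    on [T] and [x] answer yes: well-foundedness would be the projection of a
    closed relation ([computed_witness_closed]).  But every closed
    relation [Q] has a code [q] such that the paths of [section_tree q] are the
    [y] with [Q q y], so diagonalizing refutes this
    ([well_foundedness_not_closed_projection]). *)

(** * Pairs of numbers and oracle machines *)

Definition tup (a b : nat) : nat := Cantor.to_nat (a, b).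
Definition pr1 (n : nat) : nat := fst (Cantor.of_nat n).
Definition pr2 (n : nat) : nat := snd (Cantor.of_nat n).

Lemma pr1_tup a b : pr1 (tup a b) = a.
Proof. unfold pr1, tup. now rewrite Cantor.cancel_of_to. Qed.

Lemma pr2_tup a b : pr2 (tup a b) = b.
Proof. unfold pr2, tup. now rewrite Cantor.cancel_of_to. Qed.

Lemma tup_pr n : tup (pr1 n) (pr2 n) = n.
Proof. unfold tup, pr1, pr2. now rewrite <- surjective_pairing, Cantor.cancel_to_of. Qed.

Lemma tup_inj a b a' b' : tup a b = tup a' b' -> a = a' /\ b = b'.
Proof.
  intro H. split.
  - now rewrite <- (pr1_tup a b), H, pr1_tup.
  - now rewrite <- (pr2_tup a b), H, pr2_tup.
Qed.

Lemma eval_fst p n : eval p CFst n (pr1 n).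
Proof. exact eq_refl. Qed.

Lemma eval_snd p n : eval p CSnd n (pr2 n).
Proof. exact eq_refl. Qed.

Arguments tup : simpl never.
Arguments pr1 : simpl never.
Arguments pr2 : simpl never.
Arguments Cantor.to_nat : simpl never.
Arguments Cantor.of_nat : simpl never.

Definition ifz (a b c : nat) : nat := match a with 0 => b | S _ => c end.

(** Recursion is kept as one iterator, so that all number-theoretic functions
    below are recognizably built from it and shown computable by [tc_primrec]. *)
Definition primrec (b : nat) (st : nat -> nat -> nat) (k : nat) : nat :=
  nat_rect (fun _ => nat) b st k.

(** The loop inside the evaluation of [CPrec], made accessible to induction. *)
Fixpoint prec_loop (p : baire) (c d : code) (a m : nat) : nat -> Prop :=
  match m with
  | 0 => eval p c a
  | S k => fun v => exists u, prec_loop p c d a k u /\ eval p d (tup a (tup k u)) v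
  end.

Lemma eval_prec p c d n v :
  eval p (CPrec c d) n v <-> prec_loop p c d (pr1 n) (pr2 n) v.
Proof.
  cbn [eval]. unfold pr1, pr2, tup.
  generalize (snd (Cantor.of_nat n)) as m. intro m. revert v.
  induction m as [|m IH]; intro v; [reflexivity|].
  split; intros [u [H1 H2]]; exists u; split; auto; now apply IH.
Qed.

(** * Step-bounded simulation *)

(** The oracle [o] is partial: 0 means unknown and [S v] means the value [v]; the
    result is encoded in the same way.  The bound [k] is spent on unbounded
    search only, because nothing else can diverge.  In the search the state is
    0 while it goes on, 1 once it got stuck, and [S (S v)] once it stopped at [v]. *)
Fixpoint simulate (o : nat -> nat) (k : nat) (c : code) (n : nat) : nat :=
  match c with
  | CZero => 1
  | CSucc => S (S n)
  | CFst => S (pr1 n)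
  | CSnd => S (pr2 n)
  | COracle => o n
  | CPair c d =>
      ifz (simulate o k c n) 0 (ifz (simulate o k d n) 0
        (S (tup (pred (simulate o k c n)) (pred (simulate o k d n)))))
  | CComp c d => ifz (simulate o k d n) 0 (simulate o k c (pred (simulate o k d n)))
  | CPrec c d =>
      primrec (simulate o k c (pr1 n))
        (fun i u => ifz u 0 (simulate o k d (tup (pr1 n) (tup i (pred u))))) (pr2 n)
  | CMu c =>
      pred (primrec 0 (fun i u =>
        ifz u (ifz (simulate o k c (tup n i)) 1
                (ifz (pred (simulate o k c (tup n i))) (S (S i)) 0)) u) k)
  end.

Lemma simulate_sound (p : baire) o k :
  (forall i v, o i = S v -> p i = v) ->
  forall c n v, simulate o k c n = S v -> eval p c n v.
Proof.
  intros Ho c. induction c as [ | | | | |c IHc d IHd|c IHc d IHd|c IHc d IHd|c IHc];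
    intros n v H.
  - cbn in H. now injection H.
  - cbn in H. now injection H.
  - cbn in H. now injection H.
  - cbn in H. now injection H.
  - cbn in H. symmetry. now apply Ho.
  - cbn in H. destruct (simulate o k c n) as [|a] eqn:Ea; [discriminate|].
    destruct (simulate o k d n) as [|b] eqn:Eb; [discriminate|].
    cbn in H. injection H as <-. exists a, b. split; [now apply IHc|].
    split; [now apply IHd|reflexivity].
  - cbn in H. destruct (simulate o k d n) as [|a] eqn:Ea; [discriminate|].
    exists a. split; [now apply IHd|now apply IHc].
  - apply eval_prec. cbn [simulate] in H. revert v H. generalize (pr2 n) as m.
    induction m as [|m IHm]; intros v H; [now apply IHc|].
    cbn in H. fold (primrec (simulate o k c (pr1 n))
        (fun i u => ifz u 0 (simulate o k d (tup (pr1 n) (tup i (pred u))))) m) in H.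
    destruct (primrec _ _ m) as [|u]; [discriminate|].
    exists u. split; [now apply IHm|now apply IHd].
  - cbn [simulate] in H.
    set (st := fun i u => ifz u (ifz (simulate o k c (tup n i)) 1
                (ifz (pred (simulate o k c (tup n i))) (S (S i)) 0)) u) in H.
    assert (G : forall j, let r := primrec 0 st j in
      (r = 0 -> forall m, m < j -> exists l, eval p c (tup n m) (S l)) /\
      (forall w, r = S (S w) -> eval p (CMu c) n w)).
    { induction j as [|j [IH1 IH2]]; cbn.
      - split; [lia|discriminate].
      - fold (primrec 0 st j). destruct (primrec 0 st j) as [|u]; cbn.
        + specialize (IH1 eq_refl).
          destruct (simulate o k c (tup n j)) as [|[|l]] eqn:E; cbn.
          * split; discriminate.
          * split; [discriminate|]. intros w Hw. injection Hw as <-.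
            split; [now apply IHc|exact IH1].
          * split; [|discriminate]. intros _ m Hm.
            destruct (Nat.eq_dec m j) as [->|Hne]; [|apply IH1; lia].
            exists l. now apply IHc.
        + split; [discriminate|]. exact IH2. }
    apply (proj2 (G k)). cbn. destruct (primrec 0 st k) as [|[|u]];
      cbn in H; try discriminate. now injection H as ->.
Qed.

(** A halting computation looks at finitely many oracle values and makes finitely
    many searches, so any large enough bound and any oracle that knows these
    values suffice.  That all larger bounds do is needed to combine the bounds
    of the parts. *)
Lemma simulate_complete (p : baire) c n v :
  eval p c n v ->
  exists k0 m, forall k o, k0 <= k -> (forall i, i < m -> o i = S (p i)) ->
    simulate o k c n = S v.
Proof.
  revert n v. induction c as [ | | | | |c IHc d IHd|c IHc d IHd|c IHc d IHd|c IHc];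
    intros n v H.
  - exists 0, 0. cbn in *. intros; congruence.
  - exists 0, 0. cbn in *. intros; congruence.
  - exists 0, 0. cbn in *. intros; f_equal; symmetry; exact H.
  - exists 0, 0. cbn in *. intros; f_equal; symmetry; exact H.
  - exists 0, (S n). cbn in *. intros k o _ Ho. rewrite Ho; [congruence|lia].
  - destruct H as (a & b & Ha & Hb & ->).
    apply IHc in Ha. destruct Ha as (k1 & m1 & Ha).
    apply IHd in Hb. destruct Hb as (k2 & m2 & Hb).
    exists (k1 + k2), (m1 + m2). intros k o Hk Ho. cbn [simulate].
    rewrite Ha, Hb by (try lia; intros; apply Ho; lia). reflexivity.
  - destruct H as (a & Ha & Hb).
    apply IHd in Ha. destruct Ha as (k1 & m1 & Ha).
    apply IHc in Hb. destruct Hb as (k2 & m2 & Hb).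
    exists (k1 + k2), (m1 + m2). intros k o Hk Ho. cbn [simulate].
    rewrite Ha by (try lia; intros; apply Ho; lia). cbn.
    apply Hb; [lia|intros; apply Ho; lia].
  - apply eval_prec in H. cbn [simulate]. revert v H. generalize (pr2 n) as m.
    induction m as [|m IHm]; intros v H; [apply IHc, H|].
    destruct H as (u & Hu & Hv).
    apply IHm in Hu. destruct Hu as (k1 & m1 & Hu).
    apply IHd in Hv. destruct Hv as (k2 & m2 & Hv).
    exists (k1 + k2), (m1 + m2). intros k o Hk Ho. cbn.
    unfold primrec in Hu. rewrite Hu by (try lia; intros; apply Ho; lia). cbn.
    apply Hv; [lia|intros; apply Ho; lia].
  - destruct H as [H0 Hlt].
    apply IHc in H0. destruct H0 as (k1 & m1 & H0).
    assert (G : forall j, j <= v -> exists k0 m, forall k o, k0 <= k ->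
      (forall i, i < m -> o i = S (p i)) ->
      forall i, i < j -> exists l, simulate o k c (tup n i) = S (S l)).
    { induction j as [|j IHj]; intro Hj.
      - exists 0, 0. intros; lia.
      - destruct IHj as (k2 & m2 & H2); [lia|].
        destruct (Hlt j Hj) as (l & Hl). apply IHc in Hl.
        destruct Hl as (k3 & m3 & H3).
        exists (k2 + k3), (m2 + m3). intros k o Hk Ho i Hi.
        destruct (Nat.eq_dec i j) as [->|Hne].
        + exists l. apply H3; [lia|intros; apply Ho; lia].
        + apply H2; [lia|intros; apply Ho; lia|lia]. }
    destruct (G v (le_n _)) as (k2 & m2 & H2).
    exists (S v + k1 + k2), (m1 + m2). intros k o Hk Ho.
    specialize (H0 k o ltac:(lia) ltac:(intros; apply Ho; lia)).
    specialize (H2 k o ltac:(lia) ltac:(intros; apply Ho; lia)).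
    cbn [simulate].
    set (st := fun i u => ifz u (ifz (simulate o k c (tup n i)) 1
                (ifz (pred (simulate o k c (tup n i))) (S (S i)) 0)) u).
    assert (L : forall j, j <= v -> primrec 0 st j = 0).
    { induction j as [|j IHj]; intro Hj; [reflexivity|].
      cbn. fold (primrec 0 st j). rewrite IHj by lia. cbn.
      destruct (H2 j Hj) as [l ->]. reflexivity. }
    assert (M : forall j, primrec 0 st (j + S v) = S (S v)).
    { induction j as [|j IHj].
      - cbn. fold (primrec 0 st v). rewrite (L v (le_n v)). cbn.
        change (Cantor.to_nat (n, v)) with (tup n v) in H0. now rewrite H0.
      - cbn. fold (primrec 0 st (j + S v)). now rewrite IHj. }
    replace k with (k - S v + S v) at 1 by lia. now rewrite M.
Qed.

(** Two halting computations agree with one and the same simulation. *)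
Lemma eval_det p c n v v' : eval p c n v -> eval p c n v' -> v = v'.
Proof.
  intros H H'.
  destruct (simulate_complete _ _ _ _ H) as (k & m & E).
  destruct (simulate_complete _ _ _ _ H') as (k' & m' & E').
  specialize (E (k + k') (fun i => S (p i)) ltac:(lia) ltac:(auto)).
  specialize (E' (k + k') (fun i => S (p i)) ltac:(lia) ltac:(auto)).
  congruence.
Qed.

(** Use principle: the simulation that finds the value needs only a finite part of
    the oracle, and it is sound for every oracle with this part. *)
Lemma eval_use p c n v :
  eval p c n v ->
  exists m, forall p', (forall i, i < m -> p' i = p i) -> eval p' c n v.
Proof.
  intro H. destruct (simulate_complete _ _ _ _ H) as (k & m & E).
  exists m. intros p' Hp.
  apply (simulate_sound p' (fun i => if i <? m then S (p i) else 0) k).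
  - intros i w. destruct (Nat.ltb_spec i m); [|discriminate].
    intro Hw. injection Hw as <-. now apply Hp.
  - apply E; [lia|]. intros i Hi. now destruct (Nat.ltb_spec i m); [|lia].
Qed.

(** * Closure properties of computable functions *)

Definition computes (c : code) (p q : baire) : Prop := forall n, eval p c n (q n).

Lemma computes_det c p q q' : computes c p q -> computes c p q' -> q = q'.
Proof. intros H H'. extensionality n. eapply eval_det; eauto. Qed.

Fixpoint subst_oracle (e c : code) : code :=
  match c with
  | CZero => CZero | CSucc => CSucc | CFst => CFst | CSnd => CSnd
  | COracle => e
  | CPair c d => CPair (subst_oracle e c) (subst_oracle e d)
  | CComp c d => CComp (subst_oracle e c) (subst_oracle e d)
  | CPrec c d => CPrec (subst_oracle e c) (subst_oracle e d)
  | CMu c => CMu (subst_oracle e c)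
  end.

Lemma eval_subst e p q : computes e p q ->
  forall c n v, eval q c n v -> eval p (subst_oracle e c) n v.
Proof.
  intros He c. induction c as [ | | | | |c IHc d IHd|c IHc d IHd|c IHc d IHd|c IHc];
    intros n v H; try exact H.
  - cbn in H. rewrite H. apply He.
  - destruct H as (a & b & Ha & Hb & Hv). exists a, b. auto.
  - destruct H as (a & Ha & Hv). exists a. auto.
  - apply eval_prec. apply eval_prec in H. revert v H. generalize (pr2 n) as m.
    induction m as [|m IHm]; intros v H; cbn; [now apply IHc|].
    destruct H as (u & Hu & Hv). exists u. auto.
  - destruct H as [H0 Hlt]. split; [now apply IHc|].
    intros m Hm. destruct (Hlt m Hm) as [k Hk]. exists k. now apply IHc.
Qed.

Lemma computes_subst c d p q r :
  computes c p q -> computes d q r -> computes (subst_oracle c d) p r.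
Proof. intros Hc Hd n. eapply eval_subst; eauto. Qed.

(** The code is uniform in the oracle.  Such an [F] is at once a function of the
    oracle and a number, and a total map of Baire space into itself. *)
Definition total_computable (F : baire -> nat -> nat) : Prop :=
  exists c, forall p, computes c p (F p).

Lemma tc_ext F G : total_computable F -> (forall p n, F p n = G p n) -> total_computable G.
Proof. intros [c Hc] H. exists c. intros p n. rewrite <- H. apply Hc. Qed.

(** Composition on the number side. *)
Lemma tc_after F G :
  total_computable F -> total_computable G -> total_computable (fun p n => F p (G p n)).
Proof.
  intros [c Hc] [d Hd]. exists (CComp c d). intros p n. exists (G p n).
  split; [apply Hd|apply Hc].
Qed.

(** Composition of maps of Baire space. *)
Lemma tc_subst F G :
  total_computable F -> total_computable G -> total_computable (fun p n => G (F p) n).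
Proof.
  intros [c Hc] [d Hd]. exists (subst_oracle c d). intro p.
  eapply computes_subst; [apply Hc|apply Hd].
Qed.

Lemma tc_zero : total_computable (fun p n => 0).
Proof. exists CZero. intros p n. exact eq_refl. Qed.

Lemma tc_pair F G :
  total_computable F -> total_computable G ->
  total_computable (fun p n => tup (F p n) (G p n)).
Proof.
  intros [c Hc] [d Hd]. exists (CPair c d). intros p n.
  exists (F p n), (G p n). split; [apply Hc|]. split; [apply Hd|exact eq_refl].
Qed.

Lemma tc_pr1 F : total_computable F -> total_computable (fun p n => pr1 (F p n)).
Proof. apply (tc_after (fun _ n => pr1 n)). exists CFst. intros p n. apply eval_fst. Qed.

Lemma tc_pr2 F : total_computable F -> total_computable (fun p n => pr2 (F p n)).
Proof. apply (tc_after (fun _ n => pr2 n)). exists CSnd. intros p n. apply eval_snd. Qed.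

Lemma tc_S F : total_computable F -> total_computable (fun p n => S (F p n)).
Proof. apply (tc_after (fun _ n => S n)). exists CSucc. intros p n. exact eq_refl. Qed.

Lemma tc_oracle F : total_computable F -> total_computable (fun p n => p (F p n)).
Proof. apply (tc_after (fun p n => p n)). exists COracle. intros p n. exact eq_refl. Qed.

Lemma tc_id : total_computable (fun p n => n).
Proof.
  eapply tc_ext; [|intros p n; apply tup_pr].
  apply tc_pair; [exists CFst|exists CSnd]; intros p n; [apply eval_fst|apply eval_snd].
Qed.

(** The step function may mention the parameter [n]; in the code it becomes the
    first component of the input. *)
Lemma tc_primrec B St K :
  total_computable B ->
  total_computable (fun p m => St p (pr1 m) (pr1 (pr2 m)) (pr2 (pr2 m))) ->
  total_computable K ->
  total_computable (fun p n => primrec (B p n) (St p n) (K p n)).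
Proof.
  intros [b Hb] [s Hs] HK.
  assert (HR : total_computable (fun p m => primrec (B p (pr1 m)) (St p (pr1 m)) (pr2 m))).
  { exists (CPrec b s). intros p m. apply eval_prec.
    generalize (pr1 m) as a, (pr2 m) as k. intros a k.
    induction k as [|k IH]; [apply Hb|].
    cbn. exists (primrec (B p a) (St p a) k). split; [exact IH|].
    pose proof (Hs p (tup a (tup k (primrec (B p a) (St p a) k)))) as H.
    cbv beta in H. now rewrite ?pr1_tup, ?pr2_tup, ?pr1_tup in H. }
  eapply tc_ext; [apply (tc_after _ _ HR (tc_pair _ _ tc_id HK))|].
  intros p n. cbv beta. now rewrite pr1_tup, pr2_tup.
Qed.

Lemma tc_const k : total_computable (fun p n => k).
Proof. induction k; [apply tc_zero|now apply tc_S]. Qed.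

Lemma tc_ifz A B C :
  total_computable A -> total_computable B -> total_computable C ->
  total_computable (fun p n => ifz (A p n) (B p n) (C p n)).
Proof.
  intros HA HB HC.
  eapply tc_ext.
  - apply (tc_primrec B (fun p n _ _ => C p n) A HB); [|exact HA].
    apply tc_after; [exact HC|apply tc_pr1, tc_id].
  - intros p n. cbv beta. now destruct (A p n).
Qed.

Lemma tc_pred F : total_computable F -> total_computable (fun p n => pred (F p n)).
Proof.
  intro HF. eapply tc_ext.
  - apply (tc_primrec (fun _ _ => 0) (fun p n i u => i) F);
      [apply tc_const|apply tc_pr1, tc_pr2, tc_id|exact HF].
  - intros p n. cbv beta. now destruct (F p n).
Qed.

Lemma primrec_pred a k : primrec a (fun _ u => pred u) k = a - k.
Proof. induction k as [|k IH]; cbn; [lia|]. unfold primrec in IH. rewrite IH. lia. Qed.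

Lemma tc_sub F G :
  total_computable F -> total_computable G -> total_computable (fun p n => F p n - G p n).
Proof.
  intros HF HG. eapply tc_ext.
  - apply (tc_primrec F (fun _ _ _ u => pred u) G); [exact HF| |exact HG].
    apply tc_pred, tc_pr2, tc_pr2, tc_id.
  - intros p n. apply primrec_pred.
Qed.

Lemma primrec_add a k : primrec a (fun _ u => S u) k = a + k.
Proof. induction k as [|k IH]; cbn; [lia|]. unfold primrec in IH. rewrite IH. lia. Qed.

Lemma tc_add F G :
  total_computable F -> total_computable G -> total_computable (fun p n => F p n + G p n).
Proof.
  intros HF HG. eapply tc_ext.
  - apply (tc_primrec F (fun _ _ _ u => S u) G); [exact HF| |exact HG].
    apply tc_S, tc_pr2, tc_pr2, tc_id.
  - intros p n. apply primrec_add.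
Qed.

Definition total_computable2 (F : baire -> nat -> nat -> nat) : Prop :=
  total_computable (fun p m => F p (pr1 m) (pr2 m)).

Lemma tc2_after F A B :
  total_computable2 F -> total_computable A -> total_computable B ->
  total_computable (fun p n => F p (A p n) (B p n)).
Proof.
  intros HF HA HB. eapply tc_ext.
  - apply (tc_after _ _ HF (tc_pair _ _ HA HB)).
  - intros p n. cbv beta. now rewrite pr1_tup, pr2_tup.
Qed.

(** A slot for the closure properties derived below.  They have to be tried first,
    since the other steps see through definitions. *)
Ltac derived_step := fail.
Ltac computability_step := first
  [ derived_step | eassumption | apply tc_id | apply tc_const
  | apply tc_pair | apply tc_pr1 | apply tc_pr2 | apply tc_ifz
  | apply tc_S | apply tc_pred | apply tc_sub | apply tc_add
  | apply tc_oracle | apply tc_primrec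
  | match goal with
    | H : total_computable ?F |- total_computable (fun p n => ?F p (@?G p n)) =>
        apply (tc_after F G H)
    | H : total_computable2 ?F |- total_computable (fun p n => ?F p (@?A p n) (@?B p n)) =>
        apply (tc2_after F A B H)
    end ].
Ltac computability := cbv beta; repeat (progress computability_step; cbv beta).

Lemma primrec_S b st k : primrec b st (S k) = st k (primrec b st k).
Proof. reflexivity. Qed.

Definition bounded_all (f : nat -> nat) (k : nat) : nat :=
  primrec 1 (fun i u => ifz u 0 (f i)) k.

Lemma bounded_all_spec f k : bounded_all f k <> 0 <-> forall i, i < k -> f i <> 0.
Proof.
  induction k as [|k IH]; [split; [lia|discriminate]|].
  change (bounded_all f (S k)) with (ifz (bounded_all f k) 0 (f k)).
  destruct (bounded_all f k) as [|u]; cbn [ifz].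
  - split; [now intros []|]. intro H. exfalso. apply (proj2 IH); [intros; apply H; lia|reflexivity].
  - split.
    + intros H i Hi. destruct (Nat.eq_dec i k) as [->|]; [exact H|].
      apply IH; [discriminate|lia].
    + intro H. apply H. lia.
Qed.

Lemma tc_bounded_all F K :
  total_computable (fun p m => F p (pr1 m) (pr2 m)) -> total_computable K ->
  total_computable (fun p n => bounded_all (F p n) (K p n)).
Proof.
  intros HF HK. unfold bounded_all.
  apply (tc_primrec (fun _ _ => 1) (fun p n i u => ifz u 0 (F p n i)) K); computability.
  eapply tc_ext; [apply (tc_after _ (fun p m => tup (pr1 m) (pr1 (pr2 m))) HF); computability|].
  intros p n. cbv beta. now rewrite pr1_tup, pr2_tup.
Qed.

(** * Programming with codes of strings *)

(** The entry at position [i] of the string coded by [s], increased by 1; 0 beyond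
    the end.  The local [t] is the code of the [i]-th tail. *)
Definition lookup (s i : nat) : nat :=
  let t := primrec s (fun _ u => ifz u 0 (pr2 (pred u))) i in
  ifz t 0 (S (pr1 (pred t))).

Lemma tc_lookup F G :
  total_computable F -> total_computable G ->
  total_computable (fun p n => lookup (F p n) (G p n)).
Proof.
  intros HF HG. unfold lookup.
  assert (H : total_computable (fun p n => primrec (F p n) (fun _ u => ifz u 0 (pr2 (pred u))) (G p n))) by computability.
  computability.
Qed.

Lemma lookup_nil i : lookup 0 i = 0.
Proof.
  unfold lookup. replace (primrec 0 _ i) with 0; [reflexivity|].
  induction i as [|i IH]; [reflexivity|]. now rewrite primrec_S, <- IH.
Qed.

Lemma lookup_cons_0 a s : lookup (str_code (a :: s)) 0 = S a.
Proof.
  change (str_code (a :: s)) with (S (tup a (str_code s))). cbn.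
  now rewrite pr1_tup.
Qed.

Lemma lookup_cons_S a s i : lookup (str_code (a :: s)) (S i) = lookup (str_code s) i.
Proof.
  change (str_code (a :: s)) with (S (tup a (str_code s))). unfold lookup.
  replace (primrec (S (tup a (str_code s))) (fun _ u => ifz u 0 (pr2 (pred u))) (S i))
    with (primrec (str_code s) (fun _ u => ifz u 0 (pr2 (pred u))) i); [reflexivity|].
  induction i as [|i IH].
  - cbn. now rewrite pr2_tup.
  - now rewrite primrec_S, IH.
Qed.

Lemma lookup_lt s i : i < length s -> lookup (str_code s) i = S (nth i s 0).
Proof.
  revert i. induction s as [|a s IH]; intros [|i] H; cbn [length] in H; try lia.
  - apply lookup_cons_0.
  - rewrite lookup_cons_S. cbn [nth]. apply IH. lia.
Qed.

Lemma lookup_ge s i : length s <= i -> lookup (str_code s) i = 0.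
Proof.
  revert i. induction s as [|a s IH]; intros [|i] H; cbn [length] in H; try lia;
    try apply lookup_nil.
  rewrite lookup_cons_S. apply IH. lia.
Qed.

Lemma tup_ge a b : b <= tup a b.
Proof. pose proof (Cantor.to_nat_non_decreasing a b). unfold tup. lia. Qed.

Lemma str_code_ge_length s : length s <= str_code s.
Proof.
  induction s as [|a s IH]; [cbn; lia|].
  change (str_code (a :: s)) with (S (tup a (str_code s))). cbn [length].
  pose proof (tup_ge a (str_code s)). lia.
Qed.

(** Hence a search over all numbers is a search over all strings. *)
Lemma str_code_surj n : exists s, str_code s = n.
Proof.
  induction n as [[|n] IH] using lt_wf_ind; [now exists []|].
  destruct (IH (pr2 n)) as [s Hs].
  { pose proof (tup_ge (pr1 n) (pr2 n)). rewrite tup_pr in *. lia. }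
  exists (pr1 n :: s). change (S (tup (pr1 n) (str_code s)) = S n).
  now rewrite Hs, tup_pr.
Qed.

(** The last position with an entry, plus 1; the code of a string bounds its length. *)
Definition code_length (s : nat) : nat := primrec 0 (fun i u => ifz (lookup s i) u (S i)) s.

Lemma code_length_spec s : code_length (str_code s) = length s.
Proof.
  assert (H : forall k, primrec 0 (fun i u => ifz (lookup (str_code s) i) u (S i)) k
                        = Nat.min k (length s)).
  { induction k as [|k IH]; [reflexivity|]. rewrite primrec_S, IH.
    destruct (Nat.lt_ge_cases k (length s)) as [L|L].
    - rewrite (lookup_lt _ _ L). cbn [ifz]. lia.
    - rewrite (lookup_ge _ _ L). cbn [ifz]. lia. }
  unfold code_length. rewrite H. pose proof (str_code_ge_length s). lia.
Qed.

Lemma tc_code_length F :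
  total_computable F -> total_computable (fun p n => code_length (F p n)).
Proof. intro HF. unfold code_length, lookup. computability. Qed.

(** The code of the first [k] values of [g]: the string is built from its end, as
    [str_code] requires, so step [j] puts the value at [k - S j] in front. *)
Definition prefix_code (g : nat -> nat) (k : nat) : nat :=
  primrec 0 (fun j u => S (tup (g (k - S j)) u)) k.

Lemma prefix_code_spec g k : prefix_code g k = str_code (restrict g k).
Proof.
  unfold prefix_code, restrict.
  assert (H : forall j, j <= k -> primrec 0 (fun j u => S (tup (g (k - S j)) u)) j
    = str_code (map g (seq (k - j) j))).
  { induction j as [|j IH]; intro Hj; [reflexivity|].
    rewrite primrec_S, IH by lia. cbn [seq map].
    replace (S (k - S j)) with (k - j) by lia. reflexivity. }
  rewrite H by lia. now rewrite Nat.sub_diag.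
Qed.

Lemma tc_prefix_code F K :
  total_computable2 (fun p m i => F p m i) -> total_computable K ->
  total_computable (fun p n => prefix_code (F p n) (K p n)).
Proof.
  intros HF HK. unfold prefix_code.
  apply (tc_primrec (fun _ _ => 0) (fun p n j u => S (tup (F p n (K p n - S j)) u)) K);
    computability.
Qed.

(** * Pairing in Baire space *)

Definition parity (n : nat) : nat := primrec 0 (fun _ u => 1 - u) n.
Definition half (n : nat) : nat := primrec 0 (fun i u => ifz (parity i) u (S u)) n.

Lemma tc_parity F : total_computable F -> total_computable (fun p n => parity (F p n)).
Proof. intro HF. unfold parity. computability. Qed.

Lemma tc_half F : total_computable F -> total_computable (fun p n => half (F p n)).
Proof.
  intro HF. unfold half.
  apply (tc_primrec (fun _ _ => 0) (fun _ _ i u => ifz (parity i) u (S u)) F); computability.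
Qed.

Lemma parity_odd n : parity n = Nat.b2n (Nat.odd n).
Proof.
  induction n as [|n IH]; [reflexivity|]. unfold parity. rewrite primrec_S. fold (parity n).
  rewrite IH, Nat.odd_succ, <- Nat.negb_odd. now destruct (Nat.odd n).
Qed.

Lemma half_div2 n : half n = Nat.div2 n.
Proof.
  induction n as [|n IH]; [reflexivity|]. unfold half. rewrite primrec_S. fold (half n).
  rewrite IH, parity_odd. clear IH.
  enough (H : ifz (Nat.b2n (Nat.odd n)) (Nat.div2 n) (S (Nat.div2 n)) = Nat.div2 (S n) /\
    ifz (Nat.b2n (Nat.odd (S n))) (Nat.div2 (S n)) (S (Nat.div2 (S n))) = Nat.div2 (S (S n)))
    by apply H.
  induction n as [|n [H1 H2]]; [split; reflexivity|].
  split; [exact H2|].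
  change (Nat.odd (S (S n))) with (Nat.odd n).
  change (Nat.div2 (S (S n))) with (S (Nat.div2 n)).
  change (Nat.div2 (S (S (S n)))) with (S (Nat.div2 (S n))).
  rewrite <- H1. now destruct (Nat.odd n).
Qed.

Ltac derived_step ::= first
  [ apply tc_bounded_all | apply tc_lookup | apply tc_code_length | apply tc_prefix_code
  | apply tc_parity | apply tc_half ].

Lemma pairing_ifz p q n : pairing p q n = ifz (parity n) (p (half n)) (q (half n)).
Proof.
  unfold pairing. rewrite parity_odd, half_div2, <- Nat.negb_odd. now destruct (Nat.odd n).
Qed.

Definition left (p : baire) : baire := fun n => p (n + n).
Definition right (p : baire) : baire := fun n => p (S (n + n)).

Lemma left_pairing p q : left (pairing p q) = p.
Proof.
  extensionality n. unfold left, pairing. replace (n + n) with (2 * n) by lia.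
  now rewrite Nat.even_even, Nat.div2_double.
Qed.

Lemma right_pairing p q : right (pairing p q) = q.
Proof.
  extensionality n. unfold right, pairing. replace (S (n + n)) with (2 * n + 1) by lia.
  rewrite Nat.even_odd. f_equal. rewrite Nat.add_1_r. apply Nat.div2_succ_double.
Qed.

Lemma tc_pairing F G H :
  total_computable F -> total_computable G -> total_computable H ->
  total_computable (fun p n => pairing (F p) (G p) (H p n)).
Proof.
  intros HF HG HH. eapply tc_ext; [|intros p n; symmetry; apply pairing_ifz].
  apply tc_ifz; [computability| |].
  - apply (tc_after F); [exact HF|computability].
  - apply (tc_after G); [exact HG|computability].
Qed.

(** Unlike the closure properties above, this concerns codes that compute something
    for some oracles only; both values are computed and one is selected. *)
Lemma code_of_pairing a b : exists c, forall p q q',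
  computes a p q -> computes b p q' -> computes c p (pairing q q').
Proof.
  assert (Hs : total_computable (fun _ n => ifz (pr1 n) (pr1 (pr2 n)) (pr2 (pr2 n)))) by computability.
  destruct Hs as [s Hs].
  assert (He : total_computable (fun _ n => parity n)) by computability.
  assert (Hh : total_computable (fun _ n => half n)) by computability.
  destruct He as [e He], Hh as [h Hh].
  exists (CComp s (CPair e (CPair (CComp a h) (CComp b h)))).
  intros p q q' Ha Hb n. rewrite pairing_ifz.
  exists (tup (parity n) (tup (q (half n)) (q' (half n)))). split.
  - exists (parity n), (tup (q (half n)) (q' (half n))).
    split; [apply He|]. split; [|exact eq_refl].
    exists (q (half n)), (q' (half n)). split; [|split; [|exact eq_refl]].
    + exists (half n). split; [apply Hh|apply Ha].
    + exists (half n). split; [apply Hh|apply Hb].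
  - pose proof (Hs p (tup (parity n) (tup (q (half n)) (q' (half n))))) as H.
    cbv beta in H. now rewrite ?pr2_tup, ?pr1_tup, ?pr2_tup in H.
Qed.

(** For a fixed code, simulation is a total computable function of everything else.
    This compiles each code separately, which is weaker than a universal
    machine but enough for [LPO_product]. *)
Lemma tc_simulate O c :
  total_computable2 O -> forall E K G, total_computable E -> total_computable K ->
  total_computable G ->
  total_computable (fun p n => simulate (O p (E p n)) (K p n) c (G p n)).
Proof.
  intros HO. induction c as [ | | | | |c IHc d IHd|c IHc d IHd|c IHc d IHd|c IHc];
    intros E K G HE HK HG; cbn [simulate]; computability.
  - now apply IHc.
  - now apply IHd.
  - now apply IHc.
  - now apply IHd.
  - now apply IHd.
  - apply IHc; auto. computability. now apply IHd.
  - apply IHc; computability.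
  - apply (IHd (fun p m => E p (pr1 m)) (fun p m => K p (pr1 m))
      (fun p m => tup (pr1 (G p (pr1 m))) (tup (pr1 (pr2 m)) (pred (pr2 (pr2 m)))))); computability.
  - apply (IHc (fun p m => E p (pr1 m)) (fun p m => K p (pr1 m))
      (fun p m => tup (G p (pr1 m)) (pr1 (pr2 m)))); computability.
  - apply (IHc (fun p m => E p (pr1 m)) (fun p m => K p (pr1 m))
      (fun p m => tup (G p (pr1 m)) (pr1 (pr2 m)))); computability.
Qed.

(** * Weihrauch reductions given by codes *)

(** Realizers are eliminated: what counts is the behaviour on single names. *)
Definition reduces {X Y Z W : repspace} (c d : code) (f : problem X Y) (g : problem Z W) : Prop :=
  forall p x, names X p x -> dom f x ->
  exists u z, computes c p u /\ names Z u z /\ dom g z /\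
    forall v w, names W v w -> g z w ->
    exists r y, computes d (pairing p v) r /\ names Y r y /\ f x y.

Lemma computable_computes c : computable (computes c).
Proof.
  split; [intros p q q'; apply computes_det|]. exists c. intros p q H n. apply H.
Qed.

(** From a reduction one obtains this by feeding suitable realizers.  A realizer
    defined only on names of points of the domain shows that the inner map
    produces such names; changing its value at one name shows that the outer map
    copes with every admissible answer. *)
Lemma weihrauch_reduces {X Y Z W : repspace} (f : problem X Y) (g : problem Z W) :
  f <=W g <-> exists c d, reduces c d f g.
Proof.
  split.
  - intros (phi & psi & [Fphi [c Hc]] & [Fpsi [d Hd]] & HG).
    exists c, d. intros p x Hp Hx.
    destruct (choice (fun a b => forall z, names Z a z -> dom g z ->
      exists w, names W b w /\ g z w)) as [H HH].
    { intro a. destruct (classic (exists z, names Z a z /\ dom g z)) as [(z & Hz & w & Hw)|N].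
      - destruct (names_onto W w) as [b Hb]. exists b. intros z' Hz' _.
        rewrite (names_functional Z a z' z Hz' Hz). eauto.
      - exists a. intros z H1 H2. exfalso. eauto. }
    set (G0 := fun a b => (exists z, names Z a z /\ dom g z) /\ b = H a).
    assert (R0 : realizer G0 g).
    { split; [intros a b b' [_ ->] [_ ->]; reflexivity|].
      intros a z Ha Hz. destruct (HH a z Ha Hz) as (w & Hw & Hg).
      exists (H a), w. repeat split; eauto. }
    destruct (proj2 (HG G0 R0) p x Hp Hx) as (_ & _ & (u & _ & Hu & [(z & Hz & Dz) _] & _) & _).
    exists u, z. split; [intro n; now apply Hc|]. split; [exact Hz|]. split; [exact Dz|].
    intros v w Hv Hw.
    set (G := fun a b => (a = u /\ b = v) \/ (a <> u /\ G0 a b)).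
    assert (R : realizer G g).
    { split.
      - intros a b b' [[Ha Hb]|[Ha [_ Hb]]] [[Ha' Hb']|[Ha' [_ Hb']]]; congruence.
      - intros a z' Ha Hz'. destruct (classic (a = u)) as [->|N].
        + exists v, w. rewrite (names_functional Z u z' z Ha Hz).
          repeat split; auto. now left.
        + destruct (proj2 R0 a z' Ha Hz') as (q & y & Hq & Hy).
          exists q, y. split; [now right|exact Hy]. }
    destruct (proj2 (HG G R) p x Hp Hx) as (r & y & (u' & v' & Hu' & Hv' & Hr) & Hy & Hf).
    rewrite (Fphi p u' u Hu' Hu) in Hv'.
    destruct Hv' as [[_ ->]|[N _]]; [|now destruct N].
    exists r, y. split; [intro n; now apply Hd|]. now split.
  - intros (c & d & Hcd). exists (computes c), (computes d).
    split; [apply computable_computes|]. split; [apply computable_computes|].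
    intros G [FG HG]. split.
    + intros p r r' (u & v & Hu & Hv & Hr) (u' & v' & Hu' & Hv' & Hr').
      rewrite (computes_det _ _ _ _ Hu' Hu) in Hv'. rewrite (FG _ _ _ Hv' Hv) in Hr'.
      eapply computes_det; eauto.
    + intros p x Hp Hx. destruct (Hcd p x Hp Hx) as (u & z & Hu & Hz & Dz & Hout).
      destruct (HG u z Hz Dz) as (v & w & Hv & Hw & Hg).
      destruct (Hout v w Hw Hg) as (r & y & Hr & Hy & Hf).
      exists r, y. split; [|now split]. now exists u, v.
Qed.

Lemma weihrauch_refl {X Y : repspace} (f : problem X Y) : f <=W f.
Proof.
  apply weihrauch_reduces.
  assert (HR : total_computable (fun p n => right p n)) by computability.
  destruct HR as [d Hd].
  exists COracle, d. intros p x Hp Hx. exists p, x. split; [intro n; exact eq_refl|].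
  split; [exact Hp|]. split; [exact Hx|]. intros v w Hv Hw.
  exists v, w. split; [|now split]. pose proof (Hd (pairing p v)) as H.
  change (computes d (pairing p v) (right (pairing p v))) in H.
  now rewrite right_pairing in H.
Qed.

(** * Compositional products with LPO *)

Definition product_space (X Y : repspace) : repspace.
Proof.
  refine (RepSpace (X * Y)
    (fun p a => names X (left p) (fst a) /\ names Y (right p) (snd a)) _ _).
  - intros p [x y] [x' y'] [H1 H2] [H1' H2']; cbn in *.
    f_equal; eapply names_functional; eauto.
  - intros [x y]. destruct (names_onto X x) as [p Hp], (names_onto Y y) as [q Hq].
    exists (pairing p q). cbn. now rewrite left_pairing, right_pairing.
Defined.

(** The table [v] is read at an initial segment of [w] and a further number, and [j]
    codes the length of the segment together with that number. *)
Definition accepts (w v : baire) (j : nat) : nat := v (tup (prefix_code w (pr1 j)) (pr2 j)).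

Definition query : problem (product_space Baire Baire) (product_space Baire Two) :=
  fun y z => fst z = fst y /\
    (snd z = true <-> exists j, accepts (fst y) (snd y) j <> 0).

(** The solution is returned through a name, so that the table can be asked about it. *)
Definition with_side_input {X Y : repspace} (g : problem X Y) :
    problem (product_space X Baire) (product_space Baire Baire) :=
  fun a y => (exists w, names Y (fst y) w /\ g (fst a) w) /\ snd y = snd a.

Lemma bool_of_prop (P : Prop) : exists b : bool, b = true <-> P.
Proof. destruct (classic P); [now exists true|exists false; easy]. Qed.

Lemma query_total y : dom query y.
Proof.
  destruct (bool_of_prop (exists j, accepts (fst y) (snd y) j <> 0)) as [b Hb].
  now exists (fst y, b).
Qed.

Lemma LPO_total x : dom LPO x.
Proof. apply bool_of_prop. Qed.

Lemma query_LPO : query <=W LPO.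
Proof.
  apply weihrauch_reduces.
  assert (Hc : total_computable (fun p j => ifz (accepts (left p) (right p) j) 0 1)).
  { computability. }
  assert (Hd : total_computable (fun P => pairing (left (left P)) (right P))).
  { apply tc_pairing; computability. }
  destruct Hc as [c Hc], Hd as [d Hd]. exists c, d.
  intros p [w v] [Hw Hv] _. cbn in Hw, Hv. subst w v.
  set (z := fun j => negb (accepts (left p) (right p) j =? 0)).
  exists (fun j => ifz (accepts (left p) (right p) j) 0 1), z.
  split; [apply Hc|]. split.
  { intro j. unfold z. cbn. now destruct (accepts _ _ j). }
  split; [apply LPO_total|]. intros a b Ha Hb.
  exists (pairing (left p) a), (left p, b). split.
  { pose proof (Hd (pairing p a)) as H. now rewrite left_pairing, right_pairing in H. }
  cbn [names product_space fst snd]. rewrite left_pairing, right_pairing.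
  split; [now split|]. split; [reflexivity|]. cbn [fst snd]. unfold LPO in Hb. rewrite Hb.
  unfold z. split; intros [j Hj]; exists j; destruct (accepts _ _ j); easy.
Qed.

Lemma with_side_input_le {X Y : repspace} (g : problem X Y) : with_side_input g <=W g.
Proof.
  apply weihrauch_reduces.
  assert (Hc : total_computable (fun p j => left p j)) by computability.
  assert (Hd : total_computable (fun P => pairing (right P) (right (left P)))).
  { apply tc_pairing; computability. }
  destruct Hc as [c Hc], Hd as [d Hd]. exists c, d.
  intros p [x v] [Hx Hv] [_ [[w0 [_ Hw0]] _]]. cbn in Hx, Hv. subst v.
  exists (left p), x. split; [apply Hc|]. split; [exact Hx|].
  split; [now exists w0|]. intros q w Hq Hw.
  exists (pairing q (right p)), (q, right p). split.
  { pose proof (Hd (pairing p q)) as H. now rewrite left_pairing, right_pairing in H. }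
  cbn [names product_space fst snd]. rewrite left_pairing, right_pairing.
  split; [now split|]. split; [|reflexivity]. now exists w.
Qed.

(** Bits of the oracle [pairing p w], with only the part of [w] in the string coded by [s]. *)
Definition partial_pairing (p : baire) (s i : nat) : nat :=
  ifz (parity i) (S (p (half i))) (lookup s (half i)).

(** Tests whether the code [e] halts with a positive value, as far as the given finite
    part of the oracle and the given bound allow to see. *)
Definition accept_table (e : code) (p : baire) (m : nat) : nat :=
  pred (simulate (partial_pairing p (pr1 m)) (pr2 (pr2 m)) e (pr1 (pr2 m))).

Lemma tc_accept_table e : total_computable (accept_table e).
Proof.
  apply tc_pred.
  apply (tc_simulate (fun p s i => partial_pairing p s i) e); computability.
  Qed.

Lemma restrict_length f n : length (restrict f n) = n.
Proof. unfold restrict. now rewrite length_map, length_seq. Qed.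

Lemma restrict_nth f n i : i < n -> nth i (restrict f n) 0 = f i.
Proof.
  intro H. unfold restrict. rewrite nth_indep with (d' := f 0) by (now rewrite length_map, length_seq).
  now rewrite map_nth, seq_nth.
Qed.

Lemma accept_table_spec e p w :
  (exists j, accepts w (accept_table e p) j <> 0) <->
  exists n v, eval (pairing p w) e n (S v).
Proof.
  unfold accepts, accept_table. split.
  - intros [j H]. rewrite pr1_tup, pr2_tup, prefix_code_spec in H.
    set (s := str_code (restrict w (pr1 j))) in H.
    destruct (simulate (partial_pairing p s) (pr2 (pr2 j)) e (pr1 (pr2 j))) as [|[|v]] eqn:E;
      try now destruct H.
    exists (pr1 (pr2 j)), v. eapply simulate_sound; [|exact E].
    intros i x. rewrite pairing_ifz. unfold partial_pairing.
    destruct (parity i) as [|k]; cbn [ifz]; [now intros [= ->]|].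
    destruct (Nat.lt_ge_cases (half i) (pr1 j)) as [L|L].
    + unfold s. rewrite lookup_lt, restrict_nth by (rewrite ?restrict_length; lia).
      now intros [= ->].
    + unfold s. rewrite lookup_ge by (rewrite ?restrict_length; lia). discriminate.
  - intros (n & v & H). destruct (simulate_complete _ _ _ _ H) as (k & m & E).
    exists (tup m (tup n k)). rewrite !pr2_tup, !pr1_tup, prefix_code_spec.
    rewrite (E k); [easy|lia|].
    intros i Hi. rewrite pairing_ifz. unfold partial_pairing.
    destruct (parity i) as [|j]; cbn [ifz]; [reflexivity|].
    assert (half i < m).
    { rewrite half_div2. pose proof (Nat.div2_decr i i). lia. }
    now rewrite lookup_lt, restrict_nth by (rewrite ?restrict_length; lia).
Qed.

(** For problems [f1] and [g1] reducible to LPO and [g], the maps from a solution of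
    [g] to the question for LPO compose to one code [e]; its table is computable
    from the input of [g1], before any solution of [g] is known. *)
Lemma LPO_product {X Y : repspace} (g : problem X Y) :
  is_compositional_product LPO g (compose query (with_side_input g)).
Proof.
  split.
  - exists (product_space X Baire), (product_space Baire Baire), (product_space Baire Two), query, (with_side_input g).
    split; [apply query_LPO|]. split; [apply with_side_input_le|].
    split; apply weihrauch_refl.
  - intros A B C f1 g1 Hf Hg. apply weihrauch_reduces in Hf, Hg. apply weihrauch_reduces.
    destruct Hf as (c1 & d1 & Hf), Hg as (c2 & d2 & Hg).
    set (e := subst_oracle d2 c1).
    destruct (tc_accept_table e) as [cv Hcv].
    destruct (code_of_pairing c2 cv) as [c Hc].
    assert (M1 : total_computable (fun P => pairing (left P) (left (right P)))).
    { apply tc_pairing; computability. }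
    assert (M2 : total_computable (fun P n => right (right P) n)).
    { computability. }
    destruct M1 as [m1 M1], M2 as [m2 M2].
    destruct (code_of_pairing (subst_oracle m1 d2) m2) as [d Hd].
    exists c, (subst_oracle d d1). intros p a Hp [b0 [Dom [y0 [Hy0 _]]]].
    destruct (Hg p a Hp (ex_intro _ y0 Hy0)) as (u & z & Hu & Hz & Dz & Hout).
    exists (pairing u (accept_table e p)), (z, accept_table e p).
    split; [now apply Hc|]. split.
    { cbn. rewrite left_pairing, right_pairing. now split. }
    split.
    { destruct Dz as [w Hw]. destruct (names_onto Y w) as [q Hq].
      destruct (query_total (q, accept_table e p)) as [out Ho]. exists out.
      split; [intros y _; apply query_total|]. exists (q, accept_table e p).
      split; [|exact Ho]. split; [now exists w|reflexivity]. }
    intros P [q b] [Hq Hb] [_ [[q' v'] [[[w [Hqw Hw]] Hv'] [Hq' Hb']]]].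
    cbn [fst snd] in *. subst q' v'. cbn in Hq. subst q.
    destruct (Hout (left P) w Hqw Hw) as (r & y & Hr & Hry & Hy).
    destruct (Hf r y Hry (Dom y Hy)) as (l & x & Hl & Hlx & _ & Hans).
    destruct (Hans (right P) b) as (r' & z' & Hr' & Hrz' & Hz').
    + exact Hb.
    + unfold LPO. rewrite Hb', accept_table_spec.
      assert (El : computes e (pairing p (left P)) l) by (eapply computes_subst; eauto).
      split.
      * intros (n & v & Hv). exists n. pose proof (eval_det _ _ _ _ _ (El n) Hv) as K.
        rewrite (Hlx n) in K. now destruct (x n).
      * intros [n Hn]. exists n, 0. pose proof (El n) as K. rewrite (Hlx n), Hn in K. exact K.
    + exists r', z'. split; [|split; [exact Hrz'|split; [exact Dom|now exists y]]].
      eapply computes_subst; [|exact Hr']. apply Hd.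
      * eapply computes_subst; [|exact Hr].
        pose proof (M1 (pairing p P)) as K. now rewrite left_pairing, right_pairing in K.
      * pose proof (M2 (pairing p P)) as K.
        change (computes m2 (pairing p P) (right (right (pairing p P)))) in K.
        now rewrite right_pairing in K.
Qed.

(** * Branches of trees *)

Lemma restrict_S f n : restrict f (S n) = restrict f n ++ [f n].
Proof. unfold restrict. now rewrite seq_S, map_app. Qed.

Lemma restrict_le f n m : n <= m -> exists t, restrict f m = restrict f n ++ t.
Proof.
  intro H. exists (map f (seq n (m - n))). unfold restrict.
  rewrite <- map_app. f_equal. replace m with (n + (m - n)) at 1 by lia. apply seq_app.
Qed.

Lemma initial_segment_restrict f n : initial_segment (restrict f n) f.
Proof. unfold initial_segment. now rewrite restrict_length. Qed.

Lemma initial_segment_nth s f i : initial_segment s f -> i < length s -> nth i s 0 = f i.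
Proof. intros H Hi. rewrite H. now apply restrict_nth. Qed.

(** Dependent choice for strings: a property that can always be kept by appending
    one more entry holds along a whole branch. *)
Lemma build_branch (P : list nat -> Prop) (R : list nat -> nat -> Prop) s0 :
  P s0 -> (forall s, P s -> exists m, R s m /\ P (s ++ [m])) ->
  exists x, restrict x (length s0) = s0 /\
    forall n, length s0 <= n -> P (restrict x n) /\ R (restrict x n) (x n).
Proof.
  intros H0 Hstep.
  destruct (choice (fun s m => P s -> R s m /\ P (s ++ [m]))) as [next Hnext].
  { intro s. destruct (classic (P s)) as [Hs|N].
    - destruct (Hstep s Hs) as [m Hm]. now exists m.
    - exists 0. intro. contradiction. }
  set (stage := fun k => Nat.iter k (fun s => s ++ [next s]) s0).
  set (x := fun i => if i <? length s0 then nth i s0 0 else next (stage (i - length s0))).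
  assert (Hstage : forall k, restrict x (length s0 + k) = stage k).
  { induction k as [|k IH].
    - rewrite Nat.add_0_r. apply nth_ext with (d := 0) (d' := 0); [apply restrict_length|].
      rewrite restrict_length. intros i Hi. rewrite restrict_nth by exact Hi.
      unfold x. now destruct (Nat.ltb_spec i (length s0)); [|lia].
    - rewrite Nat.add_succ_r, restrict_S, IH. unfold x.
      destruct (Nat.ltb_spec (length s0 + k) (length s0)); [lia|].
      now replace (length s0 + k - length s0) with k by lia. }
  assert (HP : forall k, P (stage k)).
  { induction k as [|k IH]; [exact H0|]. apply (Hnext (stage k) IH). }
  exists x. split.
  - pose proof (Hstage 0) as K. now rewrite Nat.add_0_r in K.
  - intros n Hn. replace n with (length s0 + (n - length s0)) by lia.
    rewrite Hstage. split; [apply HP|].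
    unfold x. destruct (Nat.ltb_spec (length s0 + (n - length s0)) (length s0)); [lia|].
    replace (length s0 + (n - length s0) - length s0) with (n - length s0) by lia.
    apply Hnext, HP.
Qed.

Lemma laver_path_above (L : list nat -> Prop) s (B : nat -> nat) :
  is_laver L -> L s ->
  exists x, initial_segment s x /\ path L x /\ forall i, length s <= i -> B i <= x i.
Proof.
  intros (HT & _ & Hinf) Hs.
  destruct (build_branch L (fun s m => B (length s) <= m) s Hs) as (x & Hx & H).
  { intros r Hr. apply Hinf, Hr. }
  exists x. split; [now symmetry|]. split.
  - intro n. destruct (restrict_le x n (n + length s)) as [t Ht]; [lia|].
    apply (HT _ t). rewrite <- Ht. apply H. lia.
  - intros i Hi. destruct (H i Hi) as [_ K]. now rewrite restrict_length in K.
Qed.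

(** * The open set attached to a tree *)

(** The bound on the code of [r] makes this a bounded search. *)
Definition below_at (T : list nat -> Prop) (g : nat -> nat) (n : nat) : Prop :=
  exists r, T r /\ length r = n /\ str_code r <= g n /\ forall i, i < n -> nth i r 0 <= g i.

Definition escape_strings (T : list nat -> Prop) (s : list nat) : Prop :=
  exists n, n < length s /\ ~ below_at T (fun i => nth i s 0) n.

Lemma below_at_ext T g h n :
  (forall i, i <= n -> g i = h i) -> below_at T g n -> below_at T h n.
Proof.
  intros E (r & Hr & Hl & Hc & Hb). exists r. rewrite <- (E n) by lia.
  repeat split; auto. intros i Hi. rewrite <- E by lia. auto.
Qed.

Lemma escape_cylinders T g :
  cylinders (escape_strings T) g <-> exists n, ~ below_at T g n.
Proof.
  split.
  - intros (s & (n & Hn & N) & Hs). exists n. intro H. apply N.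
    apply (below_at_ext T g); [|exact H]. intros i Hi. symmetry.
    apply initial_segment_nth; [exact Hs|lia].
  - intros [n N]. exists (restrict g (S n)). split; [|apply initial_segment_restrict].
    exists n. rewrite restrict_length. split; [lia|]. intro H. apply N.
    eapply below_at_ext; [|exact H]. intros i Hi. apply restrict_nth. lia.
Qed.

Lemma dominating_not_escape T f g :
  path T f -> (forall i, f i + str_code (restrict f i) <= g i) ->
  ~ cylinders (escape_strings T) g.
Proof.
  intros Hf Hg H. apply escape_cylinders in H. destruct H as [n N]. apply N.
  exists (restrict f n). repeat split.
  - apply Hf.
  - apply restrict_length.
  - specialize (Hg n). lia.
  - intros i Hi. rewrite restrict_nth by exact Hi. specialize (Hg i). lia.
Qed.

(** The argument of Koenig's lemma: a string is big if it has extensions of every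
    length in [T] that stay below [g].  A big string has a big immediate successor,
    since only finitely many successors lie below [g]. *)
Lemma not_escape_path T g :
  is_tree T -> ~ cylinders (escape_strings T) g -> exists f, path T f.
Proof.
  intros HT Hg. rewrite escape_cylinders in Hg.
  set (big := fun s => forall k, exists r, length r = k /\ T (s ++ r) /\
    forall i, i < k -> nth i r 0 <= g (length s + i)).
  destruct (build_branch big (fun _ _ => True) []) as (x & _ & Hx).
  - intro k. destruct (classic (below_at T g k)) as [(r & Hr & Hl & _ & Hb)|N].
    + now exists r.
    + exfalso. apply Hg. now exists k.
  - intros s Hs. apply NNPP. intro N.
    assert (K : forall b, exists k0, forall m r, m < b -> k0 <= length r -> T ((s ++ [m]) ++ r) ->
      ~ forall i, i < length r -> nth i r 0 <= g (length (s ++ [m]) + i)).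
    { induction b as [|b [k0 IH]]; [exists 0; lia|].
      assert (Hb : ~ big (s ++ [b])) by (intro; apply N; now exists b).
      apply not_all_ex_not in Hb. destruct Hb as [k Hk].
      exists (k0 + k). intros m r Hm Hr HTr Hbd.
      destruct (Nat.eq_dec m b) as [->|Hne].
      - apply Hk. exists (firstn k r). rewrite length_firstn. split; [lia|]. split.
        + apply (HT _ (skipn k r)). now rewrite <- app_assoc, firstn_skipn.
        + intros i Hi. rewrite nth_firstn. destruct (Nat.ltb_spec i k); [|lia].
          apply Hbd. lia.
      - apply (IH m r); auto; lia. }
    destruct (K (S (g (length s)))) as [k0 Hk0].
    destruct (Hs (S k0)) as ([|m r] & Hl & HTr & Hbd); [discriminate|].
    cbn [length] in Hl. apply (Hk0 m r).
    + specialize (Hbd 0 ltac:(lia)). cbn in Hbd. rewrite Nat.add_0_r in Hbd. lia.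
    + lia.
    + now rewrite <- app_assoc.
    + intros i Hi. specialize (Hbd (S i) ltac:(lia)). cbn [nth] in Hbd.
      rewrite length_app. cbn [length].
      now replace (length s + 1 + i) with (length s + S i) by lia.
  - exists x. intro n. destruct (Hx n) as [Hn _]; [cbn; lia|].
    destruct (Hn 0) as ([|] & Hl & Hr & _); [|discriminate]. now rewrite app_nil_r in Hr.
Qed.

Lemma is_open_cylinders A : is_open (cylinders A).
Proof. now exists A. Qed.

Definition escape_set (T : list nat -> Prop) : OpenSets :=
  exist _ (cylinders (escape_strings T)) (is_open_cylinders (escape_strings T)).

Definition homogeneous (L : list nat -> Prop) (U : baire -> Prop) : Prop :=
  (forall x, path L x -> U x) \/ (forall x, path L x -> ~ U x).

Lemma homogeneous_decides T L :
  is_tree T -> is_laver L -> homogeneous L (cylinders (escape_strings T)) ->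
  ((exists f, path T f) <-> ~ exists s, L s /\ escape_strings T s).
Proof.
  intros HT HL Hhom. split.
  - intros [f Hf] (s & Hs & He).
    destruct (laver_path_above L s (fun _ => 0) HL Hs) as (x & Hsx & Hx & _).
    destruct (laver_path_above L [] (fun i => f i + str_code (restrict f i)) HL)
      as (g & _ & Hg & Hdom); [apply HL|].
    apply (dominating_not_escape T f g); [exact Hf|intro i; apply Hdom; cbn; lia|].
    destruct Hhom as [Hin|Hout]; [now apply Hin|].
    destruct (Hout x Hx). now exists s.
  - intro N. destruct (laver_path_above L [] (fun _ => 0) HL) as (g & _ & Hg & _); [apply HL|].
    apply (not_escape_path T g HT). intros (s & He & Hs). apply N. exists s.
    split; [|exact He]. rewrite Hs. apply Hg.
Qed.

(** This instance of the open Laver partition theorem is direct: either all strings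
    dominating a fixed path of [T] form a Laver tree off the set, or the set is
    everything. *)
Lemma homogeneous_exists T :
  is_tree T -> exists L, is_laver L /\ homogeneous L (cylinders (escape_strings T)).
Proof.
  intro HT. destruct (classic (exists f, path T f)) as [[f Hf]|N].
  - exists (fun s => forall i, i < length s -> f i + str_code (restrict f i) <= nth i s 0).
    split.
    + split; [|split].
      * intros s t H i Hi. specialize (H i). rewrite length_app, app_nth1 in H by exact Hi.
        apply H. lia.
      * cbn. lia.
      * intros s Hs n. exists (n + (f (length s) + str_code (restrict f (length s)))).
        split; [lia|]. intros i Hi. rewrite length_app in Hi. cbn [length] in Hi.
        destruct (Nat.lt_ge_cases i (length s)) as [L|L].
        -- rewrite app_nth1 by exact L. now apply Hs.
        -- assert (i = length s) as -> by lia. rewrite nth_middle. lia.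
    + right. intros x Hx. apply (dominating_not_escape T f); [exact Hf|].
      intro i. specialize (Hx (S i) i). rewrite restrict_length, restrict_nth in Hx by lia.
      apply Hx. lia.
  - exists (fun _ => True). split.
    + split; [easy|]. split; [easy|]. intros s _ n. now exists n.
    + left. intros x _. apply NNPP. intro H. apply N. now apply (not_escape_path T x).
Qed.

(** * Computing with homogeneous Laver trees *)

(** Nonzero unless the string coded by [c] belongs to the tree with characteristic
    function [t], has length [n] and is bounded by the string coded by [s]; the
    inner sum is 0 exactly when the length is [n]. *)
Definition not_below (t : baire) (s n c : nat) : nat :=
  ifz (t c) 1 (ifz ((code_length c - n) + (n - code_length c))
    (1 - bounded_all (fun i => 1 - (lookup c i - lookup s i)) n) 1).

(** The index is a pair of a candidate string [s] and the position [n] that should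
    witness its membership.  As [lookup] adds 1, the inner bound covers the codes
    up to the entry at [n] inclusive. *)
Definition enum_escape (t : baire) (j : nat) : nat :=
  ifz (lookup (pr1 j) (pr2 j)) 0
    (ifz (bounded_all (not_below t (pr1 j) (pr2 j)) (lookup (pr1 j) (pr2 j))) 0 (S (pr1 j))).

Lemma tc_enum_escape : total_computable enum_escape.
Proof. unfold enum_escape, not_below. computability. Qed.

Lemma not_below_spec t T s n r :
  char_name t T -> n < length s ->
  (not_below t (str_code s) n (str_code r) <> 0 <->
   ~ (T r /\ length r = n /\ forall i, i < n -> nth i r 0 <= nth i s 0)).
Proof.
  intros Ht Hn. unfold not_below. rewrite code_length_spec.
  destruct (Ht r) as [[HT ->]|[HT ->]]; cbn [ifz]; [|easy].
  destruct (length r - n + (n - length r)) as [|k] eqn:E; cbn [ifz];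
    [|split; [intros _ (_ & H & _); lia|discriminate]].
  assert (Hl : length r = n) by lia.
  set (f := fun i => 1 - (lookup (str_code r) i - lookup (str_code s) i)).
  assert (Hf : bounded_all f n <> 0 <-> forall i, i < n -> nth i r 0 <= nth i s 0).
  { rewrite bounded_all_spec. unfold f. split; intros H i Hi; specialize (H i Hi);
      rewrite !lookup_lt in * by lia; lia. }
  split.
  - intros H (_ & _ & H'). apply Hf in H'. lia.
  - intros H H'. apply H. split; [exact HT|]. split; [exact Hl|]. apply Hf. lia.
Qed.

Lemma enum_escape_spec t T s :
  char_name t T -> (enumerated (enum_escape t) s <-> escape_strings T s).
Proof.
  intro Ht.
  assert (K : forall n, n < length s ->
    (bounded_all (not_below t (str_code s) n) (lookup (str_code s) n) <> 0 <->
     ~ below_at T (fun i => nth i s 0) n)).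
  { intros n Hn. rewrite bounded_all_spec, (lookup_lt s n Hn). split.
    - intros H (r & Hr & Hl & Hc & Hb).
      apply (proj1 (not_below_spec t T s n r Ht Hn)); [apply H; lia|now split].
    - intros N c Hc. destruct (str_code_surj c) as [r <-].
      apply (not_below_spec t T s n r Ht Hn). intros (Hr & Hl & Hb).
      apply N. exists r. repeat split; auto. lia. }
  split.
  - intros [j Hj]. unfold enum_escape in Hj.
    destruct (lookup (pr1 j) (pr2 j)) as [|a] eqn:El; [discriminate|]. cbn [ifz] in Hj.
    destruct (bounded_all (not_below t (pr1 j) (pr2 j)) (S a)) as [|b] eqn:Eb; [discriminate|].
    cbn [ifz] in Hj. injection Hj as Hj. rewrite Hj in *.
    destruct (Nat.lt_ge_cases (pr2 j) (length s)) as [L|L];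
      [|rewrite (lookup_ge _ _ L) in El; discriminate].
    exists (pr2 j). split; [exact L|]. apply K; [exact L|]. now rewrite El, Eb.
  - intros (n & Hn & N). exists (tup (str_code s) n). unfold enum_escape.
    rewrite pr1_tup, pr2_tup. apply K in N; [|exact Hn].
    destruct (lookup (str_code s) n) as [|a] eqn:El;
      [rewrite (lookup_lt _ _ Hn) in El; discriminate|].
    cbn [ifz]. now destruct (bounded_all _ (S a)).
Qed.

Lemma enum_escape_names t T :
  char_name t T -> names OpenSets (enum_escape t) (escape_set T).
Proof.
  intros Ht f. cbn. split; intros (s & Hs & Hf); exists s; split; auto;
    now apply (enum_escape_spec t T s Ht).
Qed.

Lemma LL_escape_total (LT : baire -> laver_tree) (HLT : laver_representation LT) T : is_tree T -> dom (LL LT) (escape_set T).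
Proof.
  intro HT. destruct (homogeneous_exists T HT) as (L & HL & Hhom).
  destruct (LT_surjective LT HLT (exist _ L HL)) as [w Hw].
  exists w. unfold LL. rewrite Hw. exact Hhom.
Qed.

Lemma LL_decides (LT : baire -> laver_tree) T w :
  is_tree T -> LL LT (escape_set T) w ->
  ((exists f, path T f) <-> ~ exists s, proj1_sig (LT w) s /\ escape_strings T s).
Proof.
  intros HT H. apply homogeneous_decides; [exact HT|apply proj2_sig|exact H].
Qed.

(** The bits of the question put to LPO: does the Laver tree contain an enumerated string?
    The code for the characteristic function of the Laver tree comes from the
    representation. *)
Lemma meet_code (LT : baire -> laver_tree) (HLT : laver_representation LT) : exists c, forall t w T, char_name t T ->
  exists l, computes c (pairing t w) l /\ (forall j, l j = 0 \/ l j = 1) /\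
    ((exists j, l j = 1) <-> exists s, proj1_sig (LT w) s /\ escape_strings T s).
Proof.
  destruct (LT_to_char LT HLT) as (F & [_ [ct Hct]] & HF).
  assert (HM : total_computable (fun P j => ifz (enum_escape (left (left P)) j) 0
    (ifz (right P (pred (enum_escape (left (left P)) j))) 0 1))).
  { assert (H : total_computable (fun P j => enum_escape (left (left P)) j)).
    { apply (tc_subst (fun P => left (left P))); [computability|apply tc_enum_escape]. }
    computability. }
  assert (HR : total_computable (fun p j => right p j)) by computability.
  destruct HM as [cm Hm], HR as [cr Hr].
  destruct (code_of_pairing COracle (subst_oracle cr ct)) as [c Hc].
  exists (subst_oracle c cm). intros t w T Ht.
  destruct (HF w (LT w) eq_refl) as (x & Hx & Hchar).
  set (l := fun j => ifz (enum_escape t j) 0 (ifz (x (pred (enum_escape t j))) 0 1)).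
  exists l. split; [|split].
  - assert (H1 : computes c (pairing t w) (pairing (pairing t w) x)).
    { apply Hc; [intro n; exact eq_refl|]. eapply computes_subst; [apply Hr|].
      rewrite right_pairing. intro n. now apply Hct. }
    eapply computes_subst; [exact H1|].
    pose proof (Hm (pairing (pairing t w) x)) as K. cbv beta in K.
    now rewrite right_pairing, !left_pairing in K.
  - intro j. unfold l. destruct (enum_escape t j); [now left|]. cbn.
    destruct (x n); [now left|now right].
  - split.
    + intros [j Hj]. unfold l in Hj.
      destruct (enum_escape t j) as [|a] eqn:Ea; [discriminate|]. cbn in Hj.
      destruct (str_code_surj a) as [s <-]. exists s. split.
      * destruct (Hchar s) as [[H _]|[_ E]]; [exact H|]. rewrite E in Hj. discriminate.
      * apply (enum_escape_spec t T s Ht). now exists j.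
    + intros (s & Hs & He). apply (enum_escape_spec t T s Ht) in He. destruct He as [j Hj].
      exists j. unfold l. rewrite Hj. cbn.
      destruct (Hchar s) as [[_ ->]|[H _]]; [reflexivity|contradiction].
Qed.

Definition homogeneous_for_tree (LT : baire -> laver_tree) : problem Tree (product_space Tree Baire) :=
  fun T y => fst y = T /\ LL LT (escape_set (proj1_sig T)) (snd y).

Definition avoids (LT : baire -> laver_tree) : problem (product_space Tree Baire) Two :=
  fun y b => b = true <->
    ~ exists s, proj1_sig (LT (snd y)) s /\ escape_strings (proj1_sig (fst y)) s.

Lemma homogeneous_for_tree_le (LT : baire -> laver_tree) (HLT : laver_representation LT) :
  homogeneous_for_tree LT <=W LL LT.
Proof.
  apply weihrauch_reduces. destruct tc_enum_escape as [c Hc].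
  exists c, COracle. intros t T Ht _.
  exists (enum_escape t), (escape_set (proj1_sig T)).
  split; [apply Hc|]. split; [now apply enum_escape_names|].
  split; [apply (LL_escape_total LT HLT), proj2_sig|].
  intros v w Hv Hw. exists (pairing t v), (T, w). split; [intro n; exact eq_refl|].
  cbn [names product_space fst snd]. rewrite left_pairing, right_pairing. repeat split; auto.
Qed.

Lemma avoids_le (LT : baire -> laver_tree) (HLT : laver_representation LT) :
  avoids LT <=W LPO.
Proof.
  apply weihrauch_reduces. destruct (meet_code LT HLT) as [c Hc].
  assert (Hd : total_computable (fun P n => 1 - right P 0)) by computability.
  destruct Hd as [d Hd]. exists c, d.
  intros p [T w] [Ht Hw] _. cbn in Ht, Hw.
  destruct (Hc (left p) w (proj1_sig T) Ht) as (l & Hl & Hbit & Hspec).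
  assert (Ep : pairing (left p) w = p).
  { subst w. extensionality n. rewrite pairing_ifz. unfold left, right.
    rewrite half_div2, parity_odd. pose proof (Nat.div2_odd n) as E.
    destruct (Nat.odd n); cbn in *; f_equal; lia. }
  rewrite Ep in Hl. set (z := fun j => l j =? 1).
  exists l, z. split; [exact Hl|]. split.
  { intro j. unfold z. now destruct (Hbit j) as [->| ->]. }
  split; [apply LPO_total|]. intros v b Hv Hb.
  exists (fun _ => 1 - v 0), (negb b). split.
  { pose proof (Hd (pairing p v)) as K. cbv beta in K. now rewrite right_pairing in K. }
  split; [cbn in *; rewrite Hv; now destruct b|].
  unfold avoids. cbn [fst snd]. rewrite <- Hspec.
  assert (E : b = true <-> exists j, l j = 1).
  { unfold LPO in Hb. rewrite Hb. unfold z.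
    split; intros [j Hj]; exists j; now apply Nat.eqb_eq. }
  rewrite <- E. destruct b; cbn; intuition congruence.
Qed.

(** An equality of problems, so that the universal property of the product applies to WF
    itself. *)
Lemma WF_compose (LT : baire -> laver_tree) (HLT : laver_representation LT) :
  WF = compose (avoids LT) (homogeneous_for_tree LT).
Proof.
  extensionality T. extensionality b. apply propositional_extensionality.
  pose proof (proj2_sig T : is_tree (proj1_sig T)) as HT. unfold WF, compose. split.
  - intro H. split; [intros y _; apply bool_of_prop|].
    destruct (LL_escape_total LT HLT _ HT) as [w Hw]. exists (T, w).
    split; [now split|]. unfold avoids. cbn [fst snd]. rewrite H. now apply LL_decides.
  - intros [_ [[T' w] [[E Hw] Hb]]]. cbn in E, Hw. subst T'.
    unfold avoids in Hb. cbn [fst snd] in Hb. rewrite Hb. symmetry. now apply LL_decides.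
Qed.

(** * Well-foundedness is not a projection of a closed relation *)

(** The section at [p] of the closed relation coded by [p], where a closed relation
    is coded by the set of pairs of initial segments that it admits.  The section
    of [p] is taken at [p] itself, which makes [p] diagonal. *)
Definition section_tree (p : baire) (s : list nat) : Prop :=
  forall k, k <= length s -> p (tup (str_code (restrict p k)) (str_code (firstn k s))) <> 0.

Lemma section_tree_is_tree p : is_tree (section_tree p).
Proof.
  intros s t H k Hk. specialize (H k). rewrite length_app, firstn_app in H.
  replace (k - length s) with 0 in H by lia. rewrite firstn_O, app_nil_r in H.
  apply H. lia.
Qed.

Lemma firstn_restrict f k n : k <= n -> firstn k (restrict f n) = restrict f k.
Proof.
  intro H. destruct (restrict_le f k n H) as [t ->].
  rewrite firstn_app, restrict_length, Nat.sub_diag, firstn_O, app_nil_r.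
  apply firstn_all2. now rewrite restrict_length.
Qed.

Lemma section_tree_path p y :
  path (section_tree p) y <->
  forall k, p (tup (str_code (restrict p k)) (str_code (restrict y k))) <> 0.
Proof.
  split.
  - intros H k. specialize (H k k). rewrite restrict_length, firstn_restrict in H by lia.
    apply H. lia.
  - intros H n k Hk. rewrite restrict_length in Hk. now rewrite firstn_restrict.
Qed.

Definition section_char (p : baire) (s : nat) : nat :=
  ifz (bounded_all (fun k => p (tup (prefix_code p k) (prefix_code (fun i => pred (lookup s i)) k)))
    (S (code_length s))) 0 1.

Lemma tc_section_char : total_computable section_char.
Proof. unfold section_char. computability. Qed.

Lemma section_char_spec p : char_name (section_char p) (section_tree p).
Proof.
  intro s.
  assert (H : section_tree p s <->
    bounded_all (fun k => p (tup (prefix_code p k) (prefix_code (fun i => pred (lookup (str_code s) i)) k)))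
      (S (code_length (str_code s))) <> 0).
  { assert (E : forall k, k <= length s ->
      p (tup (prefix_code p k) (prefix_code (fun i => pred (lookup (str_code s) i)) k)) =
      p (tup (str_code (restrict p k)) (str_code (firstn k s)))).
    { intros k Hk. rewrite !prefix_code_spec. do 3 f_equal.
      apply nth_ext with (d := 0) (d' := 0); rewrite restrict_length, ?length_firstn; [lia|].
      intros i Hi. rewrite restrict_nth, nth_firstn, lookup_lt by lia.
      now destruct (Nat.ltb_spec i k); [|lia]. }
    rewrite bounded_all_spec, code_length_spec. unfold section_tree. split; intros H k Hk.
    - rewrite E by lia. apply H. lia.
    - rewrite <- E by lia. apply H. lia. }
  unfold section_char. destruct (bounded_all _ _) as [|b]; cbn [ifz]; [right|left]; split; auto.
  - rewrite H. now intros [].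
  - now apply H.
Qed.

Definition agree (n : nat) (p q : baire) : Prop := forall i, i < n -> p i = q i.

Lemma agree_restrict n p q : agree n p q <-> restrict p n = restrict q n.
Proof.
  split.
  - intro H. apply map_ext_in. intros i Hi. apply in_seq in Hi. apply H. lia.
  - intros H i Hi. now rewrite <- (restrict_nth p n i Hi), H, restrict_nth.
Qed.

Lemma agree_sym n p q : agree n p q -> agree n q p.
Proof. intros H i Hi. symmetry. now apply H. Qed.

Lemma agree_le n m p q : n <= m -> agree m p q -> agree n p q.
Proof. intros H K i Hi. apply K. lia. Qed.

Definition closed_relation (Q : baire -> baire -> Prop) : Prop :=
  forall p y, ~ Q p y ->
  exists n, forall p' y', agree n p p' -> agree n y y' -> ~ Q p' y'.

(** [q] codes the pairs of initial segments of members of [Q]; a pair all of whose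
    initial segments are of this kind is in [Q], because [Q] is closed. *)
Lemma closed_section (Q : baire -> baire -> Prop) :
  closed_relation Q -> exists q, forall y, path (section_tree q) y <-> Q q y.
Proof.
  intro HQ.
  destruct (choice (fun m v => v <> 0 <-> exists p y k, Q p y /\
    m = tup (str_code (restrict p k)) (str_code (restrict y k)))) as [q Hq].
  { intro m. destruct (classic (exists p y k, Q p y /\
      m = tup (str_code (restrict p k)) (str_code (restrict y k)))) as [H|N].
    - now exists 1.
    - exists 0. split; [now intros []|contradiction]. }
  exists q. intro y. rewrite section_tree_path. split.
  - intro H. apply NNPP. intro N. destruct (HQ q y N) as [n Hn].
    specialize (H n). apply Hq in H. destruct H as (p' & y' & k & HQ' & E).
    apply tup_inj in E. destruct E as [E1 E2].
    apply str_code_inj in E1, E2.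
    assert (n = k) as <-.
    { apply (f_equal (@length nat)) in E1. now rewrite !restrict_length in E1. }
    apply (Hn p' y'); [now apply agree_restrict|now apply agree_restrict|exact HQ'].
  - intros H k. apply Hq. now exists q, y, k.
Qed.

(** At the code [q] of [Q] the tree would have a path if and only if it has none. *)
Lemma well_foundedness_not_closed_projection (Q : baire -> baire -> Prop) :
  closed_relation Q ->
  ~ forall p, (exists y, Q p y) <-> ~ exists x, path (section_tree p) x.
Proof.
  intros HQ H. destruct (closed_section Q HQ) as [q Hq].
  assert (E : (exists y, Q q y) <-> exists x, path (section_tree q) x).
  { split; intros [y Hy]; exists y; now apply Hq. }
  specialize (H q). tauto.
Qed.

Definition shift (y : baire) : baire := fun n => y (S n).

Lemma agree_pairing n p q p' q' :
  agree n p p' -> agree n q q' -> agree n (pairing p q) (pairing p' q').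
Proof.
  intros Hp Hq i Hi. unfold pairing. pose proof (Nat.div2_decr i i).
  destruct (Nat.even i); [apply Hp|apply Hq]; lia.
Qed.

(** A witness consists of a path [x] of the tree computed by [a] and, in front of it,
    the position [y 0] at which the computation of [b] answers yes.  Fixing the
    position makes the condition closed: [b] is defined, hence continuous, wherever
    [x] is a path. *)
Lemma computed_witness_closed a b :
  (forall p, exists s, computes a p s) ->
  (forall p x, (forall n, eval p a (str_code (restrict x n)) 1) ->
    exists l, computes b (pairing p x) l) ->
  closed_relation (fun p y =>
    (forall n, eval p a (str_code (restrict (shift y) n)) 1) /\
    eval (pairing p (shift y)) b (y 0) 1).
Proof.
  intros Ha Hb p y N.
  destruct (classic (forall n, eval p a (str_code (restrict (shift y) n)) 1)) as [H|H].
  - destruct (Hb p (shift y) H) as [l Hl].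
    destruct (eval_use _ _ _ _ (Hl (y 0))) as [m Hm].
    exists (S m). intros p' y' Hp Hy [_ E]. apply N. split; [exact H|].
    rewrite <- (Hy 0) in E by lia.
    assert (K : l (y 0) = 1).
    { apply (eval_det (pairing p' (shift y')) b (y 0)); [|exact E]. apply Hm.
      apply agree_sym, agree_pairing; [now apply (agree_le m (S m)); [lia|]|].
      intros i Hi. apply Hy. lia. }
    rewrite <- K. apply Hl.
  - apply not_all_ex_not in H. destruct H as [n Hn].
    destruct (Ha p) as [s Hs].
    destruct (eval_use _ _ _ _ (Hs (str_code (restrict (shift y) n)))) as [m Hm].
    exists (m + S n). intros p' y' Hp Hy [E _]. apply Hn.
    assert (Er : restrict (shift y) n = restrict (shift y') n).
    { apply agree_restrict. intros i Hi. apply Hy. lia. }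
    assert (K : s (str_code (restrict (shift y) n)) = 1).
    { apply (eval_det p' a (str_code (restrict (shift y) n))); [|rewrite Er; apply E].
      apply Hm.
      intros i Hi. symmetry. apply Hp. lia. }
    rewrite <- K. apply Hs.
Qed.

(** Compose: [p], the tree [section_tree p], its open set, the tree that the reduction
    passes to [C_Baire], a path [x] of it, the homogeneous Laver tree obtained from [x],
    and the question for LPO.  The answer is the same for all [x]. *)
Lemma LL_not_le_C_Baire (LT : baire -> laver_tree) (HLT : laver_representation LT) :
  ~ (LL LT <=W C_Baire).
Proof.
  intro Hle. apply weihrauch_reduces in Hle. destruct Hle as (c & d & Hred).
  destruct (meet_code LT HLT) as [cm Hcm].
  assert (HU : total_computable (fun p n => enum_escape (section_char p) n)).
  { apply (tc_subst section_char); [apply tc_section_char|apply tc_enum_escape]. }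
  assert (M1 : total_computable (fun P => pairing (enum_escape (section_char (left P))) (right P))).
  { apply tc_pairing; [|computability|computability]. apply (tc_subst left _ ltac:(computability) HU). }
  assert (M2 : total_computable (fun P n => section_char (left P) n)).
  { exact (tc_subst left _ ltac:(computability) tc_section_char). }
  destruct HU as [cu HU], M1 as [m1 M1], M2 as [m2 M2].
  destruct (code_of_pairing m2 (subst_oracle m1 d)) as [cb Hcb].
  set (a := subst_oracle cu c). set (b := subst_oracle cb cm).
  assert (Ha : forall p, exists s S, computes a p s /\ char_name s (proj1_sig S) /\
    dom C_Baire S /\ forall x, path (proj1_sig S) x ->
    exists l, computes b (pairing p x) l /\
      ((exists x', path (section_tree p) x') <-> ~ exists j, l j = 1)).
  { intro p. pose proof (section_tree_is_tree p) as HT.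
    destruct (Hred (enum_escape (section_char p)) (escape_set (section_tree p)))
      as (s & S & Hs & HS & DS & Hout).
    - apply enum_escape_names, section_char_spec.
    - now apply LL_escape_total.
    - exists s, S. split; [eapply computes_subst; [apply HU|exact Hs]|].
      split; [exact HS|]. split; [exact DS|]. intros x Hx.
      destruct (Hout x x eq_refl Hx) as (r & w & Hr & Hw & HLL). cbn in Hw. subst w.
      destruct (Hcm (section_char p) r (section_tree p) (section_char_spec p))
        as (l & Hl & _ & Hiff).
      exists l. split; [|rewrite Hiff; now apply LL_decides].
      eapply computes_subst; [|exact Hl]. apply Hcb.
      + pose proof (M2 (pairing p x)) as K. cbv beta in K. now rewrite left_pairing in K.
      + eapply computes_subst; [|exact Hr].
        pose proof (M1 (pairing p x)) as K. now rewrite left_pairing, right_pairing in K. }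
  assert (Hpath : forall p s (S : tree) x, computes a p s -> char_name s (proj1_sig S) ->
    (path (proj1_sig S) x <-> forall n, eval p a (str_code (restrict x n)) 1)).
  { intros p s S x Hs HS. split; intros H n; specialize (H n).
    - destruct (HS (restrict x n)) as [[_ E]|[N _]]; [|contradiction].
      rewrite <- E. apply Hs.
    - destruct (HS (restrict x n)) as [[HT _]|[_ E]]; [exact HT|].
      pose proof (eval_det _ _ _ _ _ (Hs _) H). congruence. }
  eapply well_foundedness_not_closed_projection.
  - apply (computed_witness_closed a b).
    + intro p. destruct (Ha p) as (s & S & Hs & _). now exists s.
    + intros p x Hx. destruct (Ha p) as (s & S & Hs & HS & _ & H).
      destruct (H x) as (l & Hl & _); [now apply (Hpath p s S x)|]. now exists l.
  - intro p. destruct (Ha p) as (s & S & Hs & HS & [x0 Hx0] & H). split.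
    + intros [y [Hy E]]. apply (Hpath p s S _ Hs HS) in Hy.
      destruct (H _ Hy) as (l & Hl & ->). intro N. apply N. exists (y 0).
      eapply eval_det; [apply Hl|exact E].
    + intro N. destruct (H x0 Hx0) as (l & Hl & Hiff). rewrite Hiff in N.
      apply NNPP in N. destruct N as [j Hj].
      exists (fun i => match i with 0 => j | S i => x0 i end).
      change (shift _) with (fun i => x0 i). split.
      * now apply (Hpath p s S x0 Hs HS).
      * rewrite <- Hj. apply Hl.
Qed.

Theorem corollary5p13 (LT : baire -> laver_tree) (HLT : laver_representation LT) :
  (exists (X Y : repspace) (h : problem X Y),
      is_compositional_product LPO (LL LT) h /\ WF <=W h) /\
  ~ (LL LT <=W C_Baire).
Proof.
  split.
  - exists (product_space OpenSets Baire), (product_space Baire Two), (compose query (with_side_input (LL LT))).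
    split; [apply LPO_product|]. rewrite (WF_compose LT HLT).
    apply (proj2 (LPO_product (LL LT)));
      [now apply avoids_le|now apply homogeneous_for_tree_le].
  - now apply LL_not_le_C_Baire.
Qed.
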